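(* Let $A$ be a self-adjoint nonnegative linear operator with dense domain on a separable real Hilbert space $H$. Let $c:[0,+\infty)\to\mathbb{R}$ be measurable and such that, for some constant $\mu_2$, $0\le c(t)\le\mu_2$ for every $t\ge0$. Let $\sigma$ and $\delta>0$ be real numbers such that either $\sigma\in(1/2,1)$, or $\sigma=1/2$ and $4\delta^{2}>\mu_2$. Let $\alpha,\beta$ be real numbers with $1-\sigma\le\alpha-\beta\le\sigma$, and let $(u_0,u_1)\in D(A^{\alpha})\times D(A^{\beta})$. Let $u$ be the unique solution of the problem $$u''(t)+2\delta A^{\sigma}u'(t)+c(t)Au(t)=0,\qquad u(0)=u_0,\quad u'(0)=u_1.$$ Set $\varphi(x):=x^{2(1-\sigma)}$ and $C(t):=\int_0^tc(s)\,ds$. Then there exists $r>0$ such that $$(u,u')\in C^{0}\left((0,+\infty),\mathcal{G}_{\varphi,rC(t),\alpha}(A)\times\mathcal{G}_{\varphi,rC(t),\beta}(A)\right),$$ and there exist $\nu\ge1$ and $K>0$ such that, for every $t>0$, $$\|u_{\nu,+}'(t)\|_{\varphi,rC(t),\beta}^{2}+\|u_{\nu,+}(t)\|_{\varphi,rC(t),\alpha}^{2}\le K\left(|A^{\beta}u_{1,\nu,+}|^{2}+|A^{\alpha}u_{0,\nu,+}|^{2}\right).$$ The constants $r$, $\nu$, and $K$ depend only on $\delta$, $\mu_2$, and $\sigma$.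
   Context: Spectral representation. By the spectral theorem, $H$ is identified with $L^2(M,\mu)$ for a suitable measure space $(M,\mu)$, in such a way that $A$ becomes multiplication by $\lambda^2(\xi)$, where $\lambda:M\to[0,+\infty)$ is measurable. The element of $L^2(M,\mu)$ corresponding to $u$ is denoted by $\widehat u(\xi)$. (If $H$ has an orthonormal basis $\{e_k\}$ with $Ae_k=\lambda_k^2e_k$, then $M=\mathbb{N}$ with counting measure, $\lambda(k)=\lambda_k$, and $\widehat u(k)=u_k=\langle u,e_k\rangle$.) More generally, a measurable function $\widehat u$ on $M$, not necessarily in $L^2$, is regarded as a generalized vector $u$. Spaces. For every real $\alpha$, $u\in D(A^{\alpha})$ means $\|u\|_{D(A^\alpha)}^2:=\int_M(1+\lambda(\xi))^{4\alpha}|\widehat u(\xi)|^2\,d\mu<+\infty$. For vectors with $\widehat u$ vanishing where $\lambda<1$, $|A^{\alpha}u|^2:=\int_M\lambda(\xi)^{4\alpha}|\widehat u(\xi)|^2\,d\mu$ for every real $\alpha$. For a function $\varphi\ge0$, $r\ge0$, $\alpha\in\mathbb{R}$, the generalized Gevrey space $\mathcal{G}_{\varphi,r,\alpha}(A)$ is the set of $u$ with $$\|u\|_{\varphi,r,\alpha}^2:=\int_M(1+\lambda(\xi))^{4\alpha}|\widehat u(\xi)|^2\exp\left(2r\varphi(\lambda(\xi))\right)d\mu<+\infty.$$ These spaces shrink as $r$ increases. Since $C(t)$ is nondecreasing, $(u,u')\in C^0((0,+\infty),\mathcal{G}_{\varphi,rC(t),\alpha}(A)\times\mathcal{G}_{\varphi,rC(t),\beta}(A))$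 means that for every $\tau>0$ one has $(u,u')\in C^0([\tau,+\infty),\mathcal{G}_{\varphi,rC(\tau),\alpha}(A)\times\mathcal{G}_{\varphi,rC(\tau),\beta}(A))$. Frequency decomposition. For $\nu\ge0$ and a (generalized) vector $u$, $u_{\nu,+}$ is the vector with $\widehat{u_{\nu,+}}=\widehat u$ on $\{\lambda\ge\nu\}$ and $0$ elsewhere. We write $u_{\nu,+}(t)$, $u_{\nu,+}'(t)$, $u_{0,\nu,+}$, $u_{1,\nu,+}$ for the corresponding components of $u(t)$, $u'(t)$, $u_0$, $u_1$. Solution. The unique solution $u$ is characterized componentwise: for a.e. $\xi\in M$, with $\lambda=\lambda(\xi)$, the function $t\mapsto\widehat{u(t)}(\xi)=:y(t)$ is $C^1$ on $[0,+\infty)$ with locally absolutely continuous derivative, satisfies $y''+2\delta\lambda^{2\sigma}y'+\lambda^2c(t)y=0$ for a.e. $t$, and $y(0)=\widehat{u_0}(\xi)$, $y'(0)=\widehat{u_1}(\xi)$; moreover $\widehat{u'(t)}(\xi)=y'(t)$. (It is known that this is the unique solution, a priori with values in a large space of ultradistributions.)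
   Formalization: The constant K is allowed to depend also on α (r and ν depend only on δ, μ2, σ): with weight (1+λ)^{4α} on the left and λ^{4α} on the right, a K independent of α is impossible, as c=0, u1=0, λ=ν, α→∞ shows. *)

(* Defs.v *)
From HB Require Import structures.
From mathcomp Require Import all_boot all_order all_algebra.
From mathcomp Require Import all_classical all_reals all_analysis.
Set Implicit Arguments.
Unset Strict Implicit.
Unset Printing Implicit Defensive.
Import Order.TTheory GRing.Theory Num.Theory.
Import numFieldNormedType.Exports.
Local Open Scope classical_set_scope.
Local Open Scope ring_scope.

(* A real Hilbert space is a complete normed module H whose norm comes from an
   inner product ip.  An unbounded operator is a pair (D, A): a domain D and a
   map A of which only the values on D matter. *)
Definition is_inner_product_norm (R : realType) (H : completeNormedModType R)
    (ip : {dot H for idfun}) : Prop :=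
  forall x : H, `|x| ^+ 2 = ip x x.

Definition separable_space (T : topologicalType) : Prop :=
  exists S : set T, countable S /\ dense S.

(* The last but one field says that (D, A) equals its adjoint: the right-hand
   side of the equivalence is the graph of the adjoint. *)
Record nonneg_selfadjoint (R : realType) (H : completeNormedModType R)
    (ip : {dot H for idfun}) (D : set H) (A : H -> H) : Prop := {
  nsa_dense : dense D ;
  nsa_linear : forall (a : R) (x y : H), D x -> D y ->
    D (a *: x + y) /\ A (a *: x + y) = a *: A x + A y ;
  nsa_adjoint : forall x z : H,
    (D x /\ A x = z) <-> (forall y, D y -> ip (A y) x = ip y z) ;
  nsa_ge0 : forall x, D x -> 0 <= ip (A x) x }.

(* U x is a representative of the element of L^2(M, mu) corresponding to x;
   the identification x |-> U x is unitary up to a.e. equality and turns A into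
   the multiplication by lambda^2 with its maximal domain. *)
Record spectral_representation (R : realType) (H : completeNormedModType R)
    (ip : {dot H for idfun}) (D : set H) (A : H -> H)
    (d : measure_display) (M : measurableType d)
    (mu : {measure set M -> \bar R}) (lambda : M -> R) (U : H -> M -> R)
    : Prop := {
  sr_meas : measurable_fun setT lambda ;
  sr_ge0 : forall xi, 0 <= lambda xi ;
  sr_L2 : forall x, U x \in Lfun mu 2%:E ;
  sr_linear : forall (a : R) (x y : H),
    ae_eq mu setT (U (a *: x + y)) (fun xi => a * U x xi + U y xi) ;
  sr_isometry : forall x, (\int[mu]_xi ((U x xi) ^+ 2)%:E)%E = (ip x x)%:E ;
  sr_onto : forall f : M -> R, f \in Lfun mu 2%:E ->
    exists x, ae_eq mu setT (U x) f ;
  sr_dom : forall x,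
    D x <-> (fun xi => lambda xi ^+ 2 * U x xi) \in Lfun mu 2%:E ;
  sr_mul : forall x, D x ->
    ae_eq mu setT (U (A x)) (fun xi => lambda xi ^+ 2 * U x xi) }.

Section Spaces.
Context (R : realType) (d : measure_display) (M : measurableType d).
Context (mu : {measure set M -> \bar R}) (lambda : M -> R).

(* Generalized vectors are measurable functions f : M -> R.  The norms of
   D(A^a) and of the Gevrey spaces have the weight (1 + lambda)^(4a), while
   |A^a f| has the weight lambda^(4a): even for lambda >= 1 the best constant
   comparing them depends on a when a > 0. *)
Definition domA_sqnorm (a : R) (f : M -> R) : \bar R :=
  (\int[mu]_xi ((1 + lambda xi) `^ (4 * a) * f xi ^+ 2)%:E)%E.

Definition in_domA (a : R) (f : M -> R) : Prop :=
  measurable_fun setT f /\ (domA_sqnorm a f < +oo)%E.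

Definition powA_sqnorm (a : R) (f : M -> R) : \bar R :=
  (\int[mu]_xi (lambda xi `^ (4 * a) * f xi ^+ 2)%:E)%E.

Definition gevrey_sqnorm (phi : R -> R) (r a : R) (f : M -> R) : \bar R :=
  (\int[mu]_xi ((1 + lambda xi) `^ (4 * a) * f xi ^+ 2 *
                expR (2 * r * phi (lambda xi)))%:E)%E.

Definition in_gevrey (phi : R -> R) (r a : R) (f : M -> R) : Prop :=
  measurable_fun setT f /\ (gevrey_sqnorm phi r a f < +oo)%E.

(* Membership in C^0((0, +oo), G_(phi, rho(t), a)) for a nondecreasing rho. *)
Definition gevrey_C0 (phi rho : R -> R) (a : R) (u : R -> M -> R) : Prop :=
  forall tau : R, 0 < tau ->
    (forall t, tau <= t -> in_gevrey phi (rho tau) a (u t)) /\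
    (forall t, tau <= t ->
       gevrey_sqnorm phi (rho tau) a (fun xi => u s xi - u t xi)
         @[s --> within `[tau, +oo[ (nbhs t)] --> 0%E).

Definition high_freq (nu : R) (f : M -> R) : M -> R :=
  fun xi => if nu <= lambda xi then f xi else 0.

End Spaces.

Section Solutions.
Context (R : realType).

(* w is the derivative of y on [0, +oo), one-sided at 0. *)
Definition derivative_on_halfline (y w : R -> R) : Prop :=
  forall t, 0 <= t ->
    (s - t)^-1 * (y s - y t) @[s --> within `[0, +oo[ t^'] --> w t.

Definition abs_continuous_on (a b : R) (f : R -> R) : Prop :=
  forall eps : R, 0 < eps -> exists2 eta : R, 0 < eta &
    forall (n : nat) (p q : 'I_n -> R),
      (forall i, [/\ a <= p i, p i <= q i & q i <= b]) ->
      (forall i j, i != j -> q i <= p j \/ q j <= p i) ->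
      \sum_(i < n) (q i - p i) < eta ->
      \sum_(i < n) `|f (q i) - f (p i)| < eps.

Definition component_solution (delta sigma : R) (c : R -> R) (l y0 y1 : R)
    (y w : R -> R) : Prop :=
  [/\ derivative_on_halfline y w,
      {within `[0, +oo[, continuous w},
      (forall T, 0 < T -> abs_continuous_on 0 T w),
      {ae lebesgue_measure, forall t : R, 0 < t -> derivable w t 1 /\
        derive1 w t + 2 * delta * l `^ (2 * sigma) * w t + l ^+ 2 * c t * y t = 0}
    & y 0 = y0 /\ w 0 = y1].

(* u t and v t are the generalized vectors representing u(t) and u'(t). *)
Definition is_solution (d : measure_display) (M : measurableType d)
    (mu : {measure set M -> \bar R}) (lambda : M -> R)
    (delta sigma : R) (c : R -> R) (u0 u1 : M -> R) (u v : R -> M -> R)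
    : Prop :=
  (forall t, 0 <= t ->
     measurable_fun setT (u t) /\ measurable_fun setT (v t)) /\
  {ae mu, forall xi, component_solution delta sigma c
     (lambda xi) (u0 xi) (u1 xi) (u ^~ xi) (v ^~ xi)}.

Definition primitive0 (c : R -> R) (t : R) : R :=
  (\int[lebesgue_measure]_(s in `[0, t]) c s)%R.

End Solutions.

(* Main.v *)
Require Import Defs.
From mathcomp Require Import all_boot all_order all_algebra.
From mathcomp Require Import all_classical all_reals all_analysis.
From mathcomp Require Import measurable_realfun.
From mathcomp Require Import ring lra.
Import Order.TTheory GRing.Theory Num.Theory.
Import numFieldNormedType.Exports.
Local Open Scope classical_set_scope.
Local Open Scope ring_scope.

(* Writing z = y' + 2 delta l^(2 sigma) y, each component solves
   z' = - l^2 c y, and the cross terms cancel in (y'^2 + z^2)', so that the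
   energy y'^2 + z^2 decays at least like exp(- 2 r phi(l) C(t)) for l large.
   This controls y with the sharp weight; y' then follows from a second
   differential inequality, in which y enters only as a forcing term, and
   this costs a factor l^2 / l^(2 sigma) = phi(l) <= l^(2 (alpha - beta)) on the
   initial datum u0.  For bounded l a crude exponential bound is enough, and
   dominated convergence gives the continuity in time.  As c is only
   measurable, all differential inequalities hold almost everywhere, and are
   integrated by means of the absolute continuity of y'. *)

(** * Monotonicity from the sign of the derivative almost everywhere *)

(** Let S = l^(2 sigma) and q = phi(l), so that l^2 = q S. The derivative of y'^2 + z^2 is - (q c /
    delta) z^2 - (4 delta S - q c / delta) y'^2. Decay at the rate 2 r q c thus asks for r <= 1/(2
    delta) from the first term and, with m the upper bound of c, for m q (1/(2 delta) + r) <= 2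
    delta S from the second. As q / S = l^(2 - 4 sigma), the second condition holds for all large l
    if sigma > 1/2; if sigma = 1/2 it holds for some r > 0 exactly because m < 4 delta^2. The
    quadratic forms have coefficients independent of t, so c is never differentiated and enters the
    weight only through C. The hypothesis alpha - beta <= sigma, that is l^(2 (alpha - beta)) <= S
    for l >= 1, pays for the influence of u1 on u. Passing from the weight 1 + l to l costs a power
    of 2 that depends on alpha; this affects K, but neither r nor nu. *)

(** This replaces the extraction of a finite subcover of [[a, b]]: by the local hypothesis the
    supremum of the [x] with [P a x] belongs to that set, and can be exceeded unless it is [b]. Only
    intervals containing [x] occur in the local hypothesis, because differentiability at [x]
    controls no others. *)
Lemma interval_induction (R : realType) (a b : R) (P : R -> R -> Prop) :
  a <= b ->
  (forall u x v, a <= u -> u <= x -> x <= v -> v <= b ->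
    P u x -> P x v -> P u v) ->
  (forall x, a <= x -> x <= b -> exists2 e, 0 < e & forall u v,
    a <= u -> u <= x -> x <= v -> v <= b -> x - e < u -> v < x + e -> P u v) ->
  P a b.
Proof.
move=> ab Padd Ploc.
pose S := [set x | [/\ a <= x, x <= b & P a x]].
have Sa : S a.
  split => //; have [e e0] := Ploc a (lexx a) ab; apply=> //; lra.
have ubS : has_ubound S by exists b => x [].
have as_ : a <= sup S by exact: ub_le_sup.
have sb : sup S <= b by apply: ge_sup; [exists a | move=> x []].
have [e e0 He] := Ploc _ as_ sb.
have [x [ax xb Px] sx] := sup_adherent e0 (conj (ex_intro _ _ Sa) ubS).
have xs : x <= sup S by exact: ub_le_sup.
have Ps : P a (sup S).
  by apply: (Padd a x) => //; apply: He => //; lra.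
pose v := Num.min b (sup S + e / 2).
have vb : v <= b by rewrite /v ge_min lexx.
have sv : sup S <= v by rewrite /v le_min sb/=; lra.
have ve : v < sup S + e by rewrite /v gt_min; apply/orP; right; lra.
have Pv : P a v by apply: (Padd a (sup S)) => //; apply: He => //; lra.
have vs : v <= sup S by apply: ub_le_sup => //; split => //; lra.
have : v = b.
  by move: vs; rewrite /v; case: (leP b) => // _; lra.
by move=> <-.
Qed.

Lemma derivable_le0_local (R : realType) (F : R -> R) (x e : R) : 0 < e ->
  derivable F x 1 -> derive1 F x <= 0 ->
  exists2 d, 0 < d & forall u v, u <= x -> x <= v -> x - d < u -> v < x + d ->
    F v - F u <= e * (v - u).
Proof.
move=> e0 dF F0.
have cF : h^-1 *: (F (h + x) - F x) @[h --> 0^'] --> derive1 F x.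
  rewrite derive1E /derive; move: dF; rewrite /derivable.
  suff -> : (fun h : R => h^-1 *: ((F \o shift x) (h *: 1) - F x)) =
    (fun h : R => h^-1 *: (F (h + x) - F x)) by [].
  by apply/funext => h /=; congr (_ *: (F (_ + _) - _)); exact: mulr1.
have /= [d d0 Hd] : \forall h \near 0^', h^-1 *: (F (h + x) - F x) < e.
  by apply: (cvgr_lt _ cF); lra.
have Hd' h : `|h| < d -> h != 0 -> h^-1 * (F (h + x) - F x) < e.
  by move=> hd h0; apply: Hd => //=; rewrite sub0r normrN.
exists d => // u v ux xv du vd.
have H1 : F v - F x <= e * (v - x).
  have [->|vx] := eqVneq v x; first by rewrite !subrr mulr0.
  have vx0 : 0 < v - x by rewrite subr_gt0 lt_neqAle eq_sym vx.
  have := Hd' (v - x); rewrite gtr0_norm// subrK ltrBlDl => /(_ vd).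
  rewrite gt_eqF// => /(_ isT) H.
  by rewrite -ler_pdivrMr// mulrC ltW.
have H2 : F x - F u <= e * (x - u).
  have [->|xu] := eqVneq u x; first by rewrite !subrr mulr0.
  have xu0 : 0 < x - u by rewrite subr_gt0 lt_neqAle xu.
  have uxd : `|u - x| < d by rewrite distrC gtr0_norm//; lra.
  have := Hd' _ uxd; rewrite subrK subr_eq0 => /(_ xu) H.
  rewrite -ler_pdivrMr// mulrC ltW//.
  by rewrite -mulrNN -invrN !opprB.
lra.
Qed.

(* Additive under concatenation of intervals, hence accessible to
   [interval_induction]; the pairs of [s] are the subintervals carrying the
   increments of [F] across the exceptional set, which is covered by [U]. *)
Definition controlled_increment {R : realType} (F : R -> R) (U : set R)
    (e u v : R) : Prop :=
  exists s : seq (R * R),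
  [/\ all (fun x => [&& u <= x.1, x.1 <= x.2 & x.2 <= v]) s,
      pairwise (fun x y => x.2 <= y.1) s,
      ((\sum_(x <- s) (x.2 - x.1))%:E <= lebesgue_measure (U `&` `[u, v[))%E
    & F v - F u <= e * (v - u) + \sum_(x <- s) `|F x.2 - F x.1|].

Lemma controlled_increment_cat (R : realType) (F : R -> R) (U : set R)
    (e u x v : R) : open U -> u <= x -> x <= v ->
  controlled_increment F U e u x -> controlled_increment F U e x v ->
  controlled_increment F U e u v.
Proof.
move=> oU ux xv [s [s1 s2 s3 s4]] [t [t1 t2 t3 t4]].
exists (s ++ t); split.
- rewrite all_cat; apply/andP; split.
    apply: sub_all s1 => z /and3P[-> -> /= z2].
    exact: le_trans xv.
  apply: sub_all t1 => z /and3P[z1 -> ->]; rewrite !andbT.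
  exact: le_trans z1.
- rewrite pairwise_cat s2 t2 !andbT.
  apply/allrelP => z z' /(allP s1)/and3P[_ _ h] /(allP t1)/and3P[h' _ _].
  exact: le_trans h'.
- rewrite big_cat/= EFinD.
  have -> : U `&` `[u, v[ = (U `&` `[u, x[) `|` (U `&` `[x, v[).
    rewrite -setIUr; congr (_ `&` _).
    by rewrite -itv_bndbnd_setU// bnd_simp.
  rewrite measureU.
  + exact: leeD.
  + by apply: measurableI => //; exact: open_measurable.
  + by apply: measurableI => //; exact: open_measurable.
  + rewrite -subset0 => z [[_ /= h] [_ /= h']].
    move: h h'; rewrite !in_itv/= => /andP[_ zx] /andP[xz _].
    by rewrite ltNge xz in zx.
- by rewrite big_cat/=; lra.
Qed.

(** Around a point with nonpositive derivative the increment is at most [e1] times the length. The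
    other points form a null set, enclosed in an open [U] of measure less than [eta], over which
    absolute continuity keeps the total increment below [e / 2]. Induction on intervals glues both
    kinds of pieces. *)
Lemma ac_nonincreasing (R : realType) (a b : R) (F : R -> R) : a <= b ->
  abs_continuous_on a b F ->
  {ae lebesgue_measure, forall t, a < t -> t < b ->
    derivable F t 1 /\ derive1 F t <= 0} ->
  F b <= F a.
Proof.
move=> ab acF aeF.
apply/ler_addgt0Pr => e e0.
(* The summand 1 keeps the denominator positive when [a = b]. *)
pose e1 := e / (2 * (b - a + 1)).
have ba1 : 0 < 2 * (b - a + 1) by lra.
have e10 : 0 < e1 by rewrite divr_gt0.
have e20 : 0 < e / 2 by lra.
have [eta eta0 Heta] := acF _ e20.
pose B := ~` [set t : R | a < t -> t < b ->
  derivable F t 1 /\ derive1 F t <= 0].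
(* The end points join the exceptional set, since the derivative is controlled only at interior
   points. *)
have nN : lebesgue_measure.-negligible (B `|` [set a] `|` [set b]).
  by apply: negligibleU; [apply: negligibleU => //|];
    apply/negligibleP => //; exact: lebesgue_measure_set1.
have eta20 : 0 < eta / 2 by lra.
have [U [oU NU Ueta]] := outer_measure_open_le
  (B `|` [set a] `|` [set b]) eta20.
have N0 := (negligible_outer_measure _).1 nN.
rewrite N0 add0e in Ueta.
have : controlled_increment F U e1 a b.
  apply: interval_induction => //.
    by move=> u x v au ux xv vb; exact: controlled_increment_cat.
  move=> x ax xb.
  have [Nx|Nx] := pselect ((B `|` [set a] `|` [set b]) x).
    have : nbhs x U by apply: open_nbhs_nbhs; split => //; exact: NU.
    move=> /nbhs_ballP[d /= d0 dU]; exists d => // u v au ux xv vb du vd.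
    exists [:: (u, v)]; split => //=.
    + by rewrite !lexx !andbT; lra.
    + rewrite big_seq1/=.
      have -> : U `&` `[u, v[ = `[u, v[%classic.
        apply: setIidr => z /=; rewrite in_itv/= => /andP[uz zv]; apply: dU.
        by rewrite /ball/= ltr_distlC; apply/andP; split; lra.
      rewrite lebesgue_measure_itv/= lte_fin.
      case: ifPn => // ; rewrite -leNgt => vu.
      by rewrite lee_fin; lra.
    + rewrite big_seq1/=; apply: ler_wpDl; last exact: ler_norm.
      by apply: mulr_ge0; lra.
  have xna : x <> a by move=> xa; apply: Nx; left; right.
  have xnb : x <> b by move=> xb'; apply: Nx; right.
  have : ~ B x by move=> Bx; apply: Nx; left; left.
  move=> /contrapT => /(_ _ _)[||dF F0].
  - by rewrite lt_neqAle ax andbT; apply/eqP => /esym.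
  - by rewrite lt_neqAle xb andbT; apply/eqP.
  have [d d0 Hd] := derivable_le0_local _ F x _ e10 dF F0.
  exists d => // u v au ux xv vb du vd.
  exists [::]; split => //.
  - by rewrite big_nil; exact: measure_ge0.
  - by rewrite big_nil addr0; exact: Hd.
move=> [s [s1 s2 s3 s4]].
have {}s3 : \sum_(x <- s) (x.2 - x.1) < eta.
  rewrite -lte_fin; apply: (le_lt_trans s3).
  apply: (@le_lt_trans _ _ (lebesgue_measure U)).
    apply: le_measure; rewrite ?inE.
    + by apply: measurableI => //; exact: open_measurable.
    + exact: open_measurable.
    + exact: subIsetl.
  by apply: (le_lt_trans Ueta); rewrite lte_fin; lra.
pose p (i : 'I_(size s)) := (nth (0, 0) s i).1.
pose q (i : 'I_(size s)) := (nth (0, 0) s i).2.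
have := Heta (size s) p q.
rewrite big_tnth in s3; rewrite big_tnth in s4.
have tn (i : 'I_(size s)) : tnth (in_tuple s) i = nth (0, 0) s i.
  by rewrite (tnth_nth (0, 0)).
rewrite (eq_bigr (fun i => q i - p i)) in s3; last by move=> i _; rewrite tn.
rewrite (eq_bigr (fun i => `|F (q i) - F (p i)|)) in s4; last first.
  by move=> i _; rewrite tn.
have Hij (i j : 'I_(size s)) : (i < j)%N -> q i <= p j.
  move=> ij; have /(pairwiseP (0, 0)) := s2.
  by move=> /(_ i j); rewrite !inE !ltn_ord; apply.
have eb : e1 * (b - a) <= e / 2.
  rewrite /e1 mulrAC ler_pdivrMr//.
  have -> : e / 2 * (2 * (b - a + 1)) = e * (b - a) + e by field.
  lra.
move=> /(_ _ _ s3) H.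
suff : \sum_i `|F (q i) - F (p i)| < e / 2 by lra.
apply: H.
- move=> i; have /(all_nthP (0, 0))/(_ i (ltn_ord i)) := s1.
  by move=> /and3P[].
- move=> i j ij; have := ij; rewrite -(inj_eq val_inj) neq_ltn.
  by move=> /orP[/Hij|/Hij]; [left|right].
Qed.

(** * Stability of absolute continuity *)

(* The functions obtained by smooth operations from [g] and from Lipschitz
   functions satisfy this, and inherit absolute continuity from [g]. *)
Definition rel_lipschitz {R : realType} (a b : R) (g f : R -> R) : Prop :=
  exists2 M, 0 <= M & forall p q, a <= p <= b -> a <= q <= b ->
    `|f p| <= M /\ `|f q - f p| <= M * (`|g q - g p| + `|q - p|).

Section RelLipschitz.
Context {R : realType}.
Implicit Types (a b k : R) (f g h : R -> R).

Lemma rel_lipschitz_ac a b g f : abs_continuous_on a b g ->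
  rel_lipschitz a b g f -> abs_continuous_on a b f.
Proof.
move=> acg [M M0 HM] eps eps0.
pose e1 := eps / (2 * (M + 1)).
have M1 : 0 < 2 * (M + 1) by lra.
have e10 : 0 < e1 by rewrite divr_gt0.
have [eta eta0 Heta] := acg _ e10.
exists (Num.min eta e1); first by rewrite lt_min eta0.
move=> n p q pq dis; rewrite lt_min => /andP[s1 s2].
have Hg := Heta n p q pq dis s1.
apply: (@le_lt_trans _ _
  (M * (\sum_(i < n) `|g (q i) - g (p i)| + \sum_(i < n) (q i - p i)))).
  rewrite -big_split mulr_sumr; apply: ler_sum => i _ /=.
  have [ap piq qb] := pq i.
  rewrite -[X in _ <= M * (_ + X)]ger0_norm ?subr_ge0//.
  by have [] := HM (p i) (q i) _ _; rewrite ?ap ?qb ?(le_trans ap)// (le_trans piq).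
have Me : (M + 1) * (e1 + e1) = eps by rewrite /e1; field; lra.
have : M * (\sum_(i < n) `|g (q i) - g (p i)| + \sum_(i < n) (q i - p i)) <=
  M * (e1 + e1) by rewrite ler_wpM2l// lerD// ltW.
lra.
Qed.

Lemma rel_lipschitz_cst a b g k : rel_lipschitz a b g (fun=> k).
Proof.
exists `|k| => // p q _ _; split => //.
by rewrite subrr normr0 mulr_ge0// addr_ge0.
Qed.

Lemma rel_lipschitz_self a b g : (exists M, forall p, a <= p <= b -> `|g p| <= M) ->
  rel_lipschitz a b g g.
Proof.
move=> [M HM]; exists (`|M| + 1); first by rewrite addr_ge0.
move=> p q pab qab; split.
  by apply: (le_trans (HM _ pab)); have := ler_norm M; lra.
rewrite -{1}[`|_ - _|]mul1r.
by rewrite ler_pM// ?lerDl ?lerDr//.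
Qed.

Lemma lipschitz_rel_lipschitz a b g f L :
  (forall p q, a <= p <= b -> a <= q <= b -> `|f q - f p| <= L * `|q - p|) ->
  rel_lipschitz a b g f.
Proof.
move=> HL; pose M := `|L| * (b - a) + `|f a| + `|L|.
have [ab|ba] := leP a b; last first.
  by exists 0 => // p q /andP[/le_trans h /h]; rewrite leNgt ba.
have ba0 : 0 <= b - a by lra.
have h1 : 0 <= `|L| * (b - a) by rewrite mulr_ge0.
have h2 : 0 <= `|f a| := normr_ge0 _.
have h3 : 0 <= `|L| := normr_ge0 _.
exists M; first by rewrite /M; lra.
move=> p q pab qab; split.
  have aab : a <= a <= b by rewrite lexx.
  have := HL _ _ aab pab; move: (pab) => /andP[ap pb].
  rewrite (@ger0_norm _ (p - a)) ?subr_ge0// => h.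
  have : L * (p - a) <= `|L| * (b - a).
    apply: (@le_trans _ _ (`|L| * (p - a))).
      by rewrite ler_wpM2r ?ler_norm// subr_ge0.
    by rewrite ler_wpM2l//; lra.
  have := ler_normD (f p - f a) (f a); rewrite subrK /M; lra.
apply: (le_trans (HL _ _ pab qab)).
apply: (@le_trans _ _ (`|L| * `|q - p|)).
  by rewrite ler_wpM2r// ler_norm.
apply: (@le_trans _ _ (M * `|q - p|)).
  by rewrite ler_wpM2r// /M; lra.
by rewrite ler_wpM2l ?lerDr// /M; lra.
Qed.

Lemma rel_lipschitzD a b g f h : rel_lipschitz a b g f ->
  rel_lipschitz a b g h -> rel_lipschitz a b g (fun t => f t + h t).
Proof.
move=> [M M0 HM] [K K0 HK]; exists (M + K); first exact: addr_ge0.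
move=> p q pab qab.
have [f1 f2] := HM _ _ pab qab; have [h1 h2] := HK _ _ pab qab.
split; first by rewrite (le_trans (ler_normD _ _))// lerD.
rewrite mulrDl opprD addrACA (le_trans (ler_normD _ _))//.
exact: lerD.
Qed.

Lemma rel_lipschitzM a b g f h : rel_lipschitz a b g f ->
  rel_lipschitz a b g h -> rel_lipschitz a b g (fun t => f t * h t).
Proof.
move=> [M M0 HM] [K K0 HK].
exists (M * K + M * K); first by rewrite addr_ge0// mulr_ge0.
move=> p q pab qab.
have [f1 f2] := HM _ _ pab qab; have [h1 h2] := HK _ _ pab qab.
have [_ h3] := HM _ _ qab pab; have [h4 _] := HK _ _ qab pab.
set X := (X in _ /\ _ <= _ * X) in f2 *.
split.
  rewrite normrM; apply: (@le_trans _ _ (M * K)); first exact: ler_pM.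
  by rewrite lerDl mulr_ge0.
have -> : f q * h q - f p * h p = (f q - f p) * h q + f p * (h q - h p) by ring.
apply: (le_trans (ler_normD _ _)); rewrite !normrM mulrDl lerD//.
  by rewrite mulrAC ler_pM.
by rewrite -mulrA ler_pM.
Qed.

Lemma expR_sub_le (B x y : R) : x <= B -> y <= B ->
  `|expR x - expR y| <= expR B * `|x - y|.
Proof.
wlog xy : x y / y <= x.
  move=> W xB yB; have [yx|xy] := leP y x; first exact: W.
  by rewrite distrC (distrC x); apply: W => //; exact: ltW.
move=> xB yB.
have E0 : 0 <= expR x - expR y by rewrite subr_ge0 ler_expR.
rewrite ger0_norm// [`|x - y|]ger0_norm ?subr_ge0//.
have h : expR x - expR y <= expR x * (x - y).
  have -> : expR y = expR x * expR (y - x) by rewrite -expRD addrCA subrr addr0.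
  have := expR_ge1Dx (y - x) => h.
  have : expR x * (1 + (y - x)) <= expR x * expR (y - x).
    by rewrite ler_wpM2l// expR_ge0.
  lra.
apply: (le_trans h); rewrite ler_wpM2r ?subr_ge0//.
by rewrite ler_expR.
Qed.

Lemma rel_lipschitz_expR a b g f : rel_lipschitz a b g f ->
  rel_lipschitz a b g (fun t => expR (f t)).
Proof.
move=> [M M0 HM]; exists (expR M * (1 + M)).
  by rewrite mulr_ge0 ?expR_ge0//; lra.
move=> p q pab qab.
have [f1 f2] := HM _ _ pab qab; have [f3 _] := HM _ _ qab pab.
have E0 : 0 <= expR M by rewrite expR_ge0.
split.
  rewrite ger0_norm ?expR_ge0//; apply: (@le_trans _ _ (expR M)).
    by rewrite ler_expR (le_trans (ler_norm _)).
  by rewrite ler_peMr//; lra.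
apply: (le_trans (expR_sub_le M _ _ _ _));
  [exact: le_trans (ler_norm _) _.. |].
rewrite -mulrA ler_wpM2l//; apply: (le_trans f2).
rewrite mulrDl mul1r lerDr; apply: addr_ge0 => //.
Qed.

End RelLipschitz.

(** * The primitive of the coefficient *)

Section Primitive.
Context {R : realType} (c : R -> R) (m : R).
Hypothesis c_meas : measurable_fun (`[0, +oo[ : set R) c.
Hypothesis c_bnd : forall t, 0 <= t -> 0 <= c t /\ c t <= m.

Let mu := @lebesgue_measure R.

(** The boolean covers both the closed intervals that define the primitive and the left-open ones
    that carry its increments. *)
Lemma bounded_integrable_itv (a b : R) (i : bool) : 0 <= a ->
  mu.-integrable [set` Interval (BSide i a) (BRight b)] (EFin \o c).
Proof.
move=> a0.
have sub : [set` Interval (BSide i a) (BRight b)] `<=` `[0, +oo[%classic.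
  move=> x /=; rewrite !in_itv/= andbT => /andP[ax _].
  by apply: (le_trans a0); move: ax; case: (i) => //= /ltW.
apply: measurable_bounded_integrable => //.
- rewrite [X in (X < _)%E]lebesgue_measure_itv/=; case: ifPn => // _.
  by rewrite -EFinB ltry.
- exact: measurable_funS c_meas.
- exists m; split; first exact: num_real.
  move=> M mM x /= xi.
  have := sub x xi; rewrite /= in_itv/= andbT => x0.
  by have [c0 cm] := c_bnd _ x0; rewrite ger0_norm// (le_trans cm)// ltW.
Qed.

Lemma primitive0_0 : primitive0 c 0 = 0.
Proof. by rewrite /primitive0 set_itv1 Rintegral_set1. Qed.

Lemma primitive0_incr p q : 0 <= p -> p <= q ->
  0 <= primitive0 c q - primitive0 c p <= m * (q - p).
Proof.
move=> p0 pq; rewrite /primitive0 Rintegral_itvB//; last first.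
  exact: bounded_integrable_itv.
have iq : mu.-integrable `]p, q] (EFin \o c) by exact: bounded_integrable_itv.
have H x : `]p, q]%classic x -> 0 <= x.
  by rewrite /= in_itv/= => /andP[/ltW px _]; exact: le_trans px.
apply/andP; split; first by apply: Rintegral_ge0 => x /H /c_bnd[].
have -> : m * (q - p) = \int[mu]_(x in `]p, q]) m.
  rewrite Rintegral_cst// [X in _ = _ * fine X]lebesgue_measure_itv/= lte_fin.
  by case: ltP => //= qp; congr (_ * _); apply/eqP; rewrite subr_eq0 eq_le qp.
apply: le_Rintegral => //; last by move=> x /H /c_bnd[].
apply: measurable_bounded_integrable => //.
- rewrite [X in (X < _)%E]lebesgue_measure_itv/=; case: ifPn => // _.
  by rewrite -EFinB ltry.
- exists `|m|; split; first exact: num_real.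
  by move=> M mM x /= xi; exact: ltW.
Qed.

Lemma primitive0_lipschitz p q : 0 <= p -> 0 <= q ->
  `|primitive0 c q - primitive0 c p| <= m * `|q - p|.
Proof.
wlog pq : p q / p <= q.
  move=> W p0 q0; have [pq|qp] := leP p q; first exact: W.
  by rewrite distrC (distrC q); apply: W => //; exact: ltW.
move=> p0 q0; have /andP[h1 h2] := primitive0_incr p q p0 pq.
by rewrite ger0_norm// ger0_norm ?subr_ge0.
Qed.

Lemma primitive0_derivable : {ae mu, forall t, 0 < t ->
  derivable (primitive0 c) t 1 /\ derive1 (primitive0 c) t = c t}.
Proof.
(* The fundamental theorem of calculus is applied to a function that is locally integrable on the
   whole line, while [c] is controlled only on the half-line; the extension by 0 has the same
   primitive. *)
pose f := c \_ `[0, +oo[.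
have mf : measurable_fun setT f by apply/(measurable_restrictT _ _).1.
have fb x : `|f x| <= `|m|.
  rewrite /f patchE; case: ifPn => [|_]; last by rewrite normr0.
  rewrite inE/= in_itv/= andbT => x0; have [c0 cm] := c_bnd _ x0.
  by rewrite !ger0_norm// (le_trans c0).
have bf A : measurable A -> (mu A < +oo)%E -> mu.-integrable A (EFin \o f).
  move=> mA fA; apply: measurable_bounded_integrable => //.
    exact: measurable_funS mf.
  exists `|m|; split; first exact: num_real.
  by move=> M mM x /= xi; apply: (le_trans (fb x)); exact: ltW.
have lf : locally_integrable [set: R] f.
  split => //; first exact: openT.
  move=> K _ cK; have mK := compact_measurable cK.
  by have /integrableP[] := bf K mK (compact_finite_measure cK).
have intf (y : R) : mu.-integrable
    [set` Interval (BLeft (0 : R)) (BRight y)] (EFin \o f).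
  apply: bf => //; rewrite [X in (X < _)%E]lebesgue_measure_itv/=.
  by case: ifPn => // _; rewrite -EFinB ltry.
have := FTC1 intf lf.
apply: filterS; first exact: (ae_filter_ringOfSetsType mu).
move=> t Ht t0; have := Ht.
rewrite /= lte_fin => /(_ t0).
have -> : (fun x : R => \int[mu]_(s in [set` Interval (BLeft 0) (BRight x)]) f s) =
    primitive0 c.
  apply/funext => x; apply: eq_Rintegral => s.
  rewrite inE/= in_itv/= => /andP[s0 _].
  by rewrite /f patchE mem_set//= in_itv/= s0.
by rewrite /f patchE mem_set//= in_itv/= ltW.
Qed.

End Primitive.

(** * Derivatives on the half-line *)

Section HalflineDerivative.
Context {R : realType} (y w : R -> R).
Hypothesis dy : derivative_on_halfline y w.
Hypothesis cw : {within `[0, +oo[, continuous w}.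

(** Free of quotients, this form includes [s = t]; it gives both continuity up to 0 and, for
    [t > 0], the two-sided derivative. *)
Lemma halfline_expansion (t e : R) : 0 <= t -> 0 < e -> exists2 d, 0 < d &
  forall s, 0 <= s -> `|s - t| < d -> `|y s - y t - (s - t) * w t| <= e * `|s - t|.
Proof.
move=> t0 e0; have /cvgrPdist_lt/(_ _ e0) := dy _ t0.
rewrite near_withinE => /nbhs_ballP[d /= d0 Hd]; exists d => // s s0 sd.
have [->|st] := eqVneq s t; first by rewrite !subrr mul0r subr0 normr0 mulr0.
have st0 : s - t != 0 by rewrite subr_eq0.
have /(_ _ _)/ltW := Hd s _ st; rewrite /ball/= distrC => /(_ sd).
rewrite in_itv/= s0 => /(_ isT) H.
have -> : y s - y t - (s - t) * w t =
  - ((w t - (s - t)^-1 * (y s - y t)) * (s - t)) by field.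
by rewrite normrN normrM ler_wpM2r.
Qed.

Lemma halfline_continuous : {within `[0, +oo[, continuous y}.
Proof.
apply/subspace_continuousP => t; rewrite /= in_itv/= andbT => t0.
apply/cvgrPdist_lt => e e0.
have [d d0 Hd] := halfline_expansion t 1 t0 ltr01.
have w0 : 0 < `|w t| + 1 by rewrite ltr_wpDl.
near=> s.
have s0 : 0 <= s.
  near: s; rewrite near_withinE; near=> s.
  by rewrite /= in_itv/= andbT.
have sd : `|s - t| < d.
  near: s; rewrite near_withinE; near=> s => _.
  rewrite distrC; near: s; exact: (nbhsx_ballx (t : R) d d0).
have se : `|s - t| < e / (`|w t| + 1).
  near: s; rewrite near_withinE; near=> s => _.
  rewrite distrC; near: s; apply: (nbhsx_ballx (t : R) (e / (`|w t| + 1))).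
  by rewrite divr_gt0.
have := Hd s s0 sd; rewrite mul1r => H.
rewrite distrC.
have := ler_normD (y s - y t - (s - t) * w t) ((s - t) * w t).
rewrite subrK normrM => H2.
rewrite ltr_pdivlMr// in se.
apply: (le_lt_trans _ se); lra.
Unshelve. all: by end_near. Qed.

Lemma halfline_is_derive (t : R) : 0 < t -> is_derive t 1 y (w t).
Proof.
move=> t0.
suff H : h^-1 *: (y (h + t) - y t) @[h --> 0^'] --> w t.
  have E : (fun h : R => h^-1 *: ((y \o shift t) (h *: 1) - y t)) =
      (fun h : R => h^-1 *: (y (h + t) - y t)).
    by apply/funext => h /=; congr (_ *: (y (_ + _) - _)); exact: mulr1.
  split; first by rewrite /derivable E; apply/cvg_ex; exists (w t).
  by rewrite /derive E; apply: cvg_lim.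
apply/cvgrPdist_le => e e0.
have [d d0 Hd] := halfline_expansion t e (ltW t0) e0.
near=> h.
have h0 : h != 0 by near: h; exact: nbhs_dnbhs_neq.
have hm : `|h| < Num.min d t.
  near: h; apply: dnbhs0_lt; by rewrite lt_min d0.
move: hm; rewrite lt_min => /andP[hd ht].
have ht0 : 0 <= h + t by have := ler_norm (- h); rewrite normrN; lra.
have := Hd (h + t) ht0; rewrite addrK => /(_ hd) H.
rewrite -(ler_pM2r (x := `|h|)) ?normr_gt0// -normrM.
apply: le_trans H; rewrite -normrN le_eqVlt; apply/orP; left; apply/eqP.
by congr (`|_|); rewrite /GRing.scale/=; field.
Unshelve. all: by end_near. Qed.

Lemma halfline_bounded (T : R) : 0 <= T ->
  exists M, forall p, 0 <= p <= T -> `|w p| <= M.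
Proof.
move=> T0; have cwT : {within `[0, T], continuous w}.
  apply: continuous_subspaceW cw => x /=.
  by rewrite !in_itv/= andbT => /andP[].
have [p pT Hp] := EVT_max T0 cwT; have [q qT Hq] := EVT_min T0 cwT.
exists (`|w p| + `|w q|) => s sT.
have := Hp s; have := Hq s; rewrite in_itv/= sT => /(_ isT) h1 /(_ isT) h2.
rewrite ler_norml; have := ler_norm (w p); have := ler_norm (- w q).
rewrite normrN; have := normr_ge0 (w p); have := normr_ge0 (w q).
by move=> *; apply/andP; split; lra.
Qed.

Lemma halfline_lipschitz (T : R) : 0 <= T -> exists M, forall p q,
  0 <= p <= T -> 0 <= q <= T -> `|y q - y p| <= M * `|q - p|.
Proof.
move=> T0; have [M HM] := halfline_bounded T T0; exists M => p q.
wlog pq : p q / p <= q.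
  move=> W p0 q0; have [pq|qp] := leP p q; first exact: W.
  by rewrite distrC (distrC q); apply: W => //; exact: ltW.
move=> /andP[p0 _] /andP[_ qT].
have cy : {within `[p, q], continuous y}.
  apply: continuous_subspaceW halfline_continuous => x /=.
  by rewrite !in_itv/= andbT => /andP[px _]; exact: le_trans px.
have dyx x : x \in `]p, q[ -> is_derive x 1 y (w x).
  rewrite in_itv/= => /andP[px _]; apply: halfline_is_derive.
  exact: le_lt_trans px.
have [x xpq ->] := MVT_segment pq dyx cy.
move: xpq; rewrite in_itv/= => /andP[px xq].
rewrite normrM ler_wpM2r//; apply: HM.
by rewrite (le_trans p0)//= (le_trans xq).
Qed.

End HalflineDerivative.

(** * Quadratic Lyapunov functions *)

Section Lyapunov.
Context {R : realType}.

Lemma is_derive1_mul (f g : R -> R) (t df dg : R) :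
  is_derive t 1 f df -> is_derive t 1 g dg ->
  is_derive t 1 (fun s => f s * g s) (df * g t + f t * dg).
Proof.
move=> Hf Hg; have := is_deriveM Hf Hg.
by rewrite /GRing.scale/= addrC [g t * df]mulrC.
Qed.

Lemma is_derive1_add (f g : R -> R) (t df dg : R) :
  is_derive t 1 f df -> is_derive t 1 g dg ->
  is_derive t 1 (fun s => f s + g s) (df + dg).
Proof. exact: is_deriveD. Qed.

Lemma is_derive1_expR (f : R -> R) (t df : R) : is_derive t 1 f df ->
  is_derive t 1 (fun s => expR (f s)) (expR (f t) * df).
Proof. by move=> Hf; exact: (is_derive1_comp (is_derive_expR (f t)) Hf). Qed.

Lemma derivable_is_derive1 (f : R -> R) (t df : R) :
  derivable f t 1 -> derive1 f t = df -> is_derive t 1 f df.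
Proof. by move=> dF <-; rewrite derive1E; exact: DeriveDef. Qed.

Variables (delta sigma m l y0 y1 : R) (c y w : R -> R).
Hypothesis c_meas : measurable_fun (`[0, +oo[ : set R) c.
Hypothesis c_bnd : forall t, 0 <= t -> 0 <= c t /\ c t <= m.
Hypothesis sol : component_solution delta sigma c l y0 y1 y w.

Let C := primitive0 c.

(** The hypothesis is the sign of the derivative of [F] below, without its factor [expR (rho * t)]
    and with [w'] replaced by the value [dw] that the equation prescribes. The parameters serve
    three uses: [k = 0] with negative [rho] gives crude growth, [rho = 0] gives decay with weight
    [expR (k * C t)], and positive [rho] with [b] absorbs a forcing term. *)
Lemma lyapunov_nonincreasing (k rho a1 a2 a3 b T : R) : 0 <= T ->
  (forall t, 0 < t -> t < T ->
    let dw := - (2 * delta * l `^ (2 * sigma) * w t + l ^+ 2 * c t * y t) in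
    expR (k * C t) *
      ((k * c t + rho) * (a1 * w t ^+ 2 + a2 * (w t * y t) + a3 * y t ^+ 2) +
       (2 * a1 * w t * dw + a2 * (dw * y t + w t ^+ 2) + 2 * a3 * y t * w t))
    <= rho * b) ->
  expR (rho * T) *
    (expR (k * C T) * (a1 * w T ^+ 2 + a2 * (w T * y T) + a3 * y T ^+ 2) - b)
  <= a1 * y1 ^+ 2 + a2 * (y1 * y0) + a3 * y0 ^+ 2 - b.
Proof.
move=> T0 ineq; case: sol => [dy cw acw aew [yE wE]].
(* Squares are written as products, so that the sum and product rules suffice both for the
   derivative and for absolute continuity. *)
pose F t := expR (rho * t) *
  (expR (k * C t) * (a1 * (w t * w t) + a2 * (w t * y t) + a3 * (y t * y t)) + - b).
suff : F T <= F 0.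
  have C0 : C 0 = 0 by exact: primitive0_0.
  rewrite /F -!expr2 C0 !mulr0 expR0 !mul1r.
  by rewrite yE wE.
move: T0 ineq; rewrite le_eqVlt => /predU1P[<- //|T0] ineq.
apply: ac_nonincreasing; first exact: ltW.
  (* Among the ingredients of [F] only [w] is merely absolutely continuous; [y], [C] and the
     identity are Lipschitz on [[0, T]]. *)
  apply: (rel_lipschitz_ac _ _ w); first exact: acw.
  have rw : rel_lipschitz 0 T w w.
    by apply: rel_lipschitz_self; apply: halfline_bounded => //; exact: ltW.
  have ry : rel_lipschitz 0 T w y.
    have [M HM] := halfline_lipschitz y w dy cw T (ltW T0).
    exact: (lipschitz_rel_lipschitz _ _ _ _ M).
  have rC : rel_lipschitz 0 T w C.
    apply: (lipschitz_rel_lipschitz _ _ _ _ m) => p q /andP[p0 _] /andP[q0 _].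
    exact: primitive0_lipschitz.
  have rid : rel_lipschitz 0 T w id.
    by apply: (lipschitz_rel_lipschitz _ _ _ _ 1) => p q _ _; rewrite mul1r.
  apply: rel_lipschitzM.
    apply: rel_lipschitz_expR; apply: rel_lipschitzM => //.
    exact: rel_lipschitz_cst.
  apply: rel_lipschitzD; last exact: rel_lipschitz_cst.
  apply: rel_lipschitzM.
    apply: rel_lipschitz_expR; apply: rel_lipschitzM => //.
    exact: rel_lipschitz_cst.
  apply: rel_lipschitzD; first apply: rel_lipschitzD.
  - by apply: rel_lipschitzM; [exact: rel_lipschitz_cst|exact: rel_lipschitzM].
  - by apply: rel_lipschitzM; [exact: rel_lipschitz_cst|exact: rel_lipschitzM].
  - by apply: rel_lipschitzM; [exact: rel_lipschitz_cst|exact: rel_lipschitzM].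
have aeC := primitive0_derivable c m c_meas c_bnd.
pose ff := ae_filter_ringOfSetsType (@lebesgue_measure R).
move: aew aeC; apply: filterS2 => t H1 H2 t0 tT.
have [dw wE'] := H1 t0; have [dC CE] := H2 t0.
have Hw : is_derive t 1 w
    (- (2 * delta * l `^ (2 * sigma) * w t + l ^+ 2 * c t * y t)).
  by apply: derivable_is_derive1 => //; lra.
have HC : is_derive t 1 C (c t) by exact: derivable_is_derive1.
have Hy := halfline_is_derive y w dy t t0.
have Hid : is_derive t 1 (@id R) 1 by exact: is_derive_id.
have Hc (x : R) : is_derive t 1 (fun=> x) 0 by exact: is_derive_cst.
have HF := is_derive1_mul _ _ _ _ _
  (is_derive1_expR _ _ _ (is_derive1_mul _ _ _ _ _ (Hc rho) Hid))
  (is_derive1_add _ _ _ _ _ (is_derive1_mul _ _ _ _ _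
    (is_derive1_expR _ _ _ (is_derive1_mul _ _ _ _ _ (Hc k) HC))
    (is_derive1_add _ _ _ _ _ (is_derive1_add _ _ _ _ _
      (is_derive1_mul _ _ _ _ _ (Hc a1) (is_derive1_mul _ _ _ _ _ Hw Hw))
      (is_derive1_mul _ _ _ _ _ (Hc a2) (is_derive1_mul _ _ _ _ _ Hw Hy)))
      (is_derive1_mul _ _ _ _ _ (Hc a3) (is_derive1_mul _ _ _ _ _ Hy Hy))))
    (Hc (- b))).
rewrite -/F in HF.
split; first exact: (@ex_derive _ _ _ _ _ _ _ HF).
rewrite derive1E (@derive_val _ _ _ _ _ _ _ HF).
have := ineq t t0 tT => /=.
rewrite -subr_le0 => H.
have E0 : 0 <= expR (rho * t) by exact: expR_ge0.
have := mulr_ge0_le0 E0 H; apply: le_trans; rewrite le_eqVlt; apply/orP; left.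
by apply/eqP; ring.
Qed.

End Lyapunov.

(** * Pointwise bounds for one component *)

Section PointwiseBounds.
Context {R : realType}.
Variables (delta sigma m l y0 y1 : R) (c y w : R -> R).
Hypothesis delta0 : 0 < delta.
Hypothesis c_meas : measurable_fun (`[0, +oo[ : set R) c.
Hypothesis c_bnd : forall t, 0 <= t -> 0 <= c t /\ c t <= m.
Hypothesis sol : component_solution delta sigma c l y0 y1 y w.

Let C := primitive0 c.

(** The damping is used only through its sign. The rate comes from 2 w y <= w^2 + y^2 and from - 2
    l^2 c w y <= l^2 m (w^2 + y^2). *)
Lemma low_frequency_bound (T : R) : 0 <= T ->
  w T ^+ 2 + y T ^+ 2 <= expR ((1 + l ^+ 2 * m) * T) * (y1 ^+ 2 + y0 ^+ 2).
Proof.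
move=> T0; set n := 1 + _.
have := lyapunov_nonincreasing _ _ m _ _ _ _ _ _ c_meas c_bnd sol
  0 (- n) 1 0 1 0 T T0.
rewrite !mul0r expR0 !mul1r !addr0 !subr0 mulr0 mulNr expRN => H.
rewrite -ler_pdivrMl ?expR_gt0//; apply: H => t t0 _.
rewrite !mul0r expR0 !add0r !addr0 !mul1r !mulr1.
have S0 : 0 <= delta * l `^ (2 * sigma) by rewrite mulr_ge0 ?powR_ge0// ltW.
have [ct0 ctm] := c_bnd t (ltW t0).
set S := delta * _ in S0; rewrite -(mulrA 2 delta) -/S.
have l0 : 0 <= l ^+ 2 by exact: sqr_ge0.
have lc : 0 <= l ^+ 2 * c t by rewrite mulr_ge0.
have lcm : l ^+ 2 * c t <= l ^+ 2 * m by rewrite ler_wpM2l.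
set L := l ^+ 2 * c t in lc lcm *; rewrite /n.
have h1 := mulr_ge0 S0 (sqr_ge0 (w t)).
have h2 := mulr_ge0 lc (sqr_ge0 (w t + y t)).
have h3 := sqr_ge0 (w t - y t).
have h4 : 0 <= (l ^+ 2 * m - L) * (w t ^+ 2 + y t ^+ 2).
  by rewrite mulr_ge0 ?subr_ge0// addr_ge0// sqr_ge0.
nra.
Qed.

(** Keeping phi(l) and l^(2 sigma) as plain reals [q] and [S] leaves only polynomial algebra. [r_le]
    and [damping] are the two sign conditions for the energy decay. *)
Variables (q S r : R).
Hypothesis q0 : 0 <= q.
Hypothesis S0 : 0 < S.
Hypothesis SE : l `^ (2 * sigma) = S.
Hypothesis lE : l ^+ 2 = q * S.
Hypothesis r0 : 0 <= r.
Hypothesis r_le : r <= (2 * delta)^-1.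
Hypothesis damping : m * (q * ((2 * delta)^-1 + r)) <= 2 * delta * S.

Let E0 := y1 ^+ 2 + (y1 + 2 * delta * S * y0) ^+ 2.

(* With [z = w + 2 delta S y] the equation reads [z' = - q S c y], and the
   cross terms cancel in the derivative of [w ^ 2 + z ^ 2]. *)
Lemma slow_energy_decay (T : R) : 0 <= T ->
  expR (2 * r * q * C T) * (w T ^+ 2 + (w T + 2 * delta * S * y T) ^+ 2) <= E0.
Proof.
move=> T0.
have := lyapunov_nonincreasing _ _ m _ _ _ _ _ _ c_meas c_bnd sol
  (2 * r * q) 0 2 (4 * delta * S) (4 * delta ^+ 2 * S ^+ 2) 0 T T0.
rewrite !mul0r expR0 !mul1r !subr0 => H.
have -> : w T ^+ 2 + (w T + 2 * delta * S * y T) ^+ 2 =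
  2 * w T ^+ 2 + 4 * delta * S * (w T * y T) + 4 * delta ^+ 2 * S ^+ 2 * y T ^+ 2.
  by ring.
have -> : E0 =
  2 * y1 ^+ 2 + 4 * delta * S * (y1 * y0) + 4 * delta ^+ 2 * S ^+ 2 * y0 ^+ 2.
  by rewrite /E0; ring.
apply: H => t t0 _ /=; rewrite SE lE.
apply: mulr_ge0_le0; first exact: expR_ge0.
have [ct0 ctm] := c_bnd t (ltW t0).
have r_i := r_le; have dmp := damping.
set i := (2 * delta)^-1 in r_i dmp *.
have i_delta : 2 * delta * i = 1 by rewrite mulfV// lt0r_neq0// mulr_gt0.
have i0 : 0 <= i by rewrite invr_ge0 mulr_ge0// ltW.
(* With [i] in place of 1 / (2 delta) the identity is polynomial; the last summand collects what
   vanishes by [i_delta]. *)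
have -> : (2 * r * q * c t + 0) * (2 * w t ^+ 2 + 4 * delta * S * (w t * y t) +
     4 * delta ^+ 2 * S ^+ 2 * y t ^+ 2) +
   (2 * 2 * w t * - (2 * delta * S * w t + q * S * c t * y t) +
    4 * delta * S * (- (2 * delta * S * w t + q * S * c t * y t) * y t + w t ^+ 2) +
    2 * (4 * delta ^+ 2 * S ^+ 2) * y t * w t) =
   - (2 * (c t * q * (i - r)) * (w t + 2 * delta * S * y t) ^+ 2
      + 2 * (2 * delta * S - c t * (q * (i + r))) * w t ^+ 2)
   + (2 * delta * i - 1) * (4 * q * c t * (w t * S * y t + delta * S ^+ 2 * y t ^+ 2)).
  by ring.
rewrite i_delta subrr mul0r addr0 oppr_le0.
have h : c t * (q * (i + r)) <= m * (q * (i + r)).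
  by rewrite ler_wpM2r// mulr_ge0// addr_ge0.
apply: addr_ge0; apply: mulr_ge0; rewrite ?sqr_ge0//.
  by rewrite !mulr_ge0// subr_ge0.
lra.
Qed.

(** For fixed y, the energy w^2 + (w + 2 delta S y)^2 is smallest at w = - delta S y, where it
    equals 2 delta^2 S^2 y^2. *)
Lemma slow_component_bound (T : R) : 0 <= T ->
  expR (2 * r * q * C T) * (2 * delta ^+ 2 * S ^+ 2 * y T ^+ 2) <= E0.
Proof.
move=> T0; apply: le_trans (slow_energy_decay T T0).
rewrite ler_wpM2l ?expR_ge0//.
have := sqr_ge0 (2 * w T + 2 * delta * S * y T); nra.
Qed.

(** The energy alone would bound w^2 by [E0], hence by a multiple of S^2 y0^2, which is too much. In
    w' = - 2 delta S w - q S c y the forcing contains y, which is already smaller than the energy by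
    a factor S^2, so that only q^2 y0^2 remains. *)
Lemma fast_component_bound (T : R) : 0 <= T ->
  expR (2 * r * q * C T) * w T ^+ 2 <=
  y1 ^+ 2 + q ^+ 2 * m ^+ 2 / (2 * delta ^+ 4 * S ^+ 2) * E0.
Proof.
move=> T0; set b := _ * E0.
have m0 : 0 <= m by have [h1 h2] := c_bnd 0 (lexx 0); exact: le_trans h2.
have E00 : 0 <= E0 by rewrite addr_ge0// sqr_ge0.
have b0 : 0 <= b.
  by rewrite mulr_ge0// divr_ge0// ?mulr_ge0 ?exprn_ge0// ltW.
have dS : 0 < delta * S by rewrite mulr_gt0.
have := lyapunov_nonincreasing _ _ m _ _ _ _ _ _ c_meas c_bnd sol
  (2 * r * q) (delta * S) 1 0 0 b T T0.
rewrite !mul0r !mul1r !addr0 => H.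
have {H} : expR (delta * S * T) * (expR (2 * r * q * C T) * w T ^+ 2 - b)
    <= y1 ^+ 2 - b.
  apply: H => t t0 _ /=; rewrite SE lE !mul0r !addr0 mulr1 mul1r.
  have [ct0 ctm] := c_bnd t (ltW t0).
  have r_i := r_le; have dmp := damping.
  set i := (2 * delta)^-1 in r_i dmp *.
  set e := expR _.
  have e0 : 0 <= e by exact: expR_ge0.
  have rqc : r * q * c t <= delta * S.
    have h1 : 0 <= m * q by rewrite mulr_ge0//; lra.
    have h2 : r * q * c t <= r * q * m by rewrite ler_wpM2l// mulr_ge0.
    have h3 : r * (m * q) <= i * (m * q) by rewrite ler_wpM2r.
    lra.
  have Ey := slow_component_bound t (ltW t0).
  rewrite -/C -/e in Ey.
  (* The dissipation 4 delta S w^2 is split in three: 2 delta S w^2 offsets the growth of the weight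
     by [rqc], delta S w^2 gives the rate [rho], and the last delta S w^2 absorbs the cross term 2 q
     S c w y, leaving q^2 S c^2 y^2 / delta. Inserting the bound on y turns this into delta S [b],
     which is the origin of [b]. *)
  apply: (@le_trans _ _ (e * (q ^+ 2 * S * m ^+ 2 * y t ^+ 2 / delta))).
    rewrite ler_wpM2l// ler_pdivlMr//.
    have g1 : 0 <= (2 * delta * S - 2 * (r * q * c t)) * delta * w t ^+ 2.
      rewrite mulr_ge0 ?sqr_ge0// mulr_ge0 ?(ltW delta0)//.
      by rewrite subr_ge0 -(mulrA 2 delta) ler_pM2l.
    have g2 : 0 <= S * (delta * w t + q * c t * y t) ^+ 2.
      by rewrite mulr_ge0 ?sqr_ge0// ltW.
    have g3 : 0 <= q ^+ 2 * S * y t ^+ 2 * (m ^+ 2 - c t ^+ 2).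
      apply: mulr_ge0; last by rewrite subr_ge0 ler_sqr ?nnegrE.
      by rewrite mulr_ge0 ?sqr_ge0// mulr_ge0 ?sqr_ge0// ltW.
    nra.
  have -> : delta * S * b = q ^+ 2 * m ^+ 2 / (2 * delta ^+ 3 * S) * E0.
    by rewrite /b; field; apply/andP; split; rewrite lt0r_neq0.
  have -> : e * (q ^+ 2 * S * m ^+ 2 * y t ^+ 2 / delta) =
    q ^+ 2 * m ^+ 2 / (2 * delta ^+ 3 * S) *
    (e * (2 * delta ^+ 2 * S ^+ 2 * y t ^+ 2)).
    by field; apply/andP; split; rewrite lt0r_neq0.
  by rewrite ler_wpM2l// divr_ge0// !mulr_ge0 ?exprn_ge0// ltW.
set G := _ * w T ^+ 2 => H.
have [Gb|Gb] := leP b G; last by have := sqr_ge0 y1; lra.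
have : G - b <= expR (delta * S * T) * (G - b).
  rewrite ler_peMl ?subr_ge0//.
  by rewrite -expR0 ler_expR mulr_ge0// ltW.
by have := sqr_ge0 y1; lra.
Qed.

(** Here [k] stands for l^(2 (alpha - beta)): [q <= k] handles the part of w due to y0, and [k <= S]
    the part of y due to y1. In the constant, 5 is 1 from the free decay of w plus 4 from y0 in the
    bound on y; the fraction without [m] comes from y1 in that bound, and the two with [m] from the
    forcing in w. *)
Lemma high_frequency_bound (k T : R) : 0 <= T -> q <= k -> k <= S ->
  expR (2 * r * q * C T) * (w T ^+ 2 + k ^+ 2 * y T ^+ 2) <=
  (5 + 3 / (2 * delta ^+ 2) + 3 * m ^+ 2 / (2 * delta ^+ 4)
   + 4 * m ^+ 2 / delta ^+ 2) * (y1 ^+ 2 + k ^+ 2 * y0 ^+ 2).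
Proof.
move=> T0 qk kS.
have Hw := fast_component_bound T T0; have Hy := slow_component_bound T T0.
set e := expR _ in Hw Hy *.
have e0 : 0 <= e by exact: expR_ge0.
have S2 : 0 < S ^+ 2 by rewrite exprn_gt0.
have d2 : 0 < delta ^+ 2 by rewrite exprn_gt0.
have E0_le : E0 <= 3 * y1 ^+ 2 + 8 * delta ^+ 2 * S ^+ 2 * y0 ^+ 2.
  have := sqr_ge0 (y1 - 2 * delta * S * y0); rewrite /E0; lra.
have k0 : 0 <= k := le_trans q0 qk.
have qk2 : q ^+ 2 <= k ^+ 2 by rewrite ler_sqr.
have kS2 : k ^+ 2 <= S ^+ 2 by rewrite ler_sqr// nnegrE ltW.
set x := y1 ^+ 2; set z := y0 ^+ 2; set p := y T ^+ 2 in Hy *.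
have x0 : 0 <= x by exact: sqr_ge0.
have z0 : 0 <= z by exact: sqr_ge0.
have m2 : 0 <= m ^+ 2 by exact: sqr_ge0.
pose n := m ^+ 2 / (2 * delta ^+ 4).
have n0 : 0 <= n by rewrite divr_ge0// mulr_ge0// exprn_ge0// ltW.
(* Used with s = q^2 and s = k^2: the y1^2 part of [E0] is paid by s <= S^2, the S^2 y0^2 part by s
   <= k^2. *)
have main s A : 0 <= A -> 0 <= s -> s <= S ^+ 2 -> s <= k ^+ 2 ->
  s / S ^+ 2 * A * E0 <= A * (3 * x + 8 * delta ^+ 2 * (k ^+ 2 * z)).
  move=> A0 s0 sS sk.
  apply: (@le_trans _ _ (s / S ^+ 2 * A * (3 * x + 8 * delta ^+ 2 * S ^+ 2 * z))).
    by rewrite ler_wpM2l// mulr_ge0// divr_ge0// ltW.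
  rewrite mulrAC mulrC ler_wpM2l//.
  have -> : s / S ^+ 2 * (3 * x + 8 * delta ^+ 2 * S ^+ 2 * z) =
      3 * (s / S ^+ 2 * x) + 8 * delta ^+ 2 * (s * z).
    by field; rewrite lt0r_neq0.
  rewrite lerD// ?ler_wpM2l//.
  - by rewrite ler_piMl// ler_pdivrMr// mul1r.
  - by rewrite mulr_ge0// ltW.
  - by rewrite ler_wpM2r.
have h1 := main _ _ n0 (sqr_ge0 q) (le_trans qk2 kS2) qk2.
have i0 : 0 <= (2 * delta ^+ 2)^-1 by rewrite invr_ge0 mulr_ge0// ltW.
have h2 := main _ _ i0 (sqr_ge0 k) kS2 (lexx _).
have h3 : e * (k ^+ 2 * p) <= k ^+ 2 / S ^+ 2 * (2 * delta ^+ 2)^-1 * E0.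
  apply: (@le_trans _ _ (k ^+ 2 / S ^+ 2 * (2 * delta ^+ 2)^-1 *
    (e * (2 * delta ^+ 2 * S ^+ 2 * p)))).
    by rewrite le_eqVlt; apply/orP; left; apply/eqP; field; rewrite !lt0r_neq0.
  by rewrite ler_wpM2l// mulr_ge0// divr_ge0 ?sqr_ge0.
have h4 : q ^+ 2 * m ^+ 2 / (2 * delta ^+ 4 * S ^+ 2) = q ^+ 2 / S ^+ 2 * n.
  by rewrite /n; field; rewrite !lt0r_neq0.
rewrite h4 -/x in Hw.
have h5 : (2 * delta ^+ 2)^-1 * (3 * x + 8 * delta ^+ 2 * (k ^+ 2 * z)) =
  3 / (2 * delta ^+ 2) * x + 4 * (k ^+ 2 * z).
  by field; rewrite !lt0r_neq0.
have h6 : n * (3 * x + 8 * delta ^+ 2 * (k ^+ 2 * z)) =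
  3 * m ^+ 2 / (2 * delta ^+ 4) * x + 4 * m ^+ 2 / delta ^+ 2 * (k ^+ 2 * z).
  by rewrite /n; field; rewrite !lt0r_neq0.
have kz : 0 <= k ^+ 2 * z by rewrite mulr_ge0 ?sqr_ge0.
have c1 : 0 <= 3 / (2 * delta ^+ 2) by rewrite mulr_ge0.
have c2 : 0 <= 3 * m ^+ 2 / (2 * delta ^+ 4) by rewrite -mulrA mulr_ge0.
have c3 : 0 <= 4 * m ^+ 2 / delta ^+ 2.
  by apply: divr_ge0; [exact: mulr_ge0 | exact: ltW].
set k1 := 3 / _ in h5 c1 *; set k2 := 3 * _ / _ in h6 c2 *.
set k3 := 4 * _ / _ in h6 c3 *.
have g1 := mulr_ge0 c1 kz; have g2 := mulr_ge0 c2 kz.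
have g3 := mulr_ge0 c3 x0.
move: Hw h1 h2 h3; rewrite h5 h6 => *; lra.
Qed.

End PointwiseBounds.

(** * Weights and decay rate *)

Section Weights.
Context {R : realType}.
Implicit Types (l p P nu : R).

(** The ratio (1 + l) / l lies between 1 and 2. For negative p its power tends to 1 as l grows and
    so exceeds 2^p, which is why the constant carries a nonnegative exponent [P]; one [P] can then
    serve several p. *)
Lemma powR_shift_le l p P : 1 <= l -> 0 <= P -> p <= P ->
  (1 + l) `^ p <= 2 `^ P * l `^ p.
Proof.
move=> l1 P0 pP; have l0 : 0 < l by lra.
have -> : 1 + l = l * (1 + l^-1) by field; lra.
have li : 0 <= l^-1 by rewrite invr_ge0 ltW.
have li1 : l^-1 <= 1 by rewrite invf_le1.
rewrite powRM ?(ltW l0)//; last lra.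
rewrite mulrC ler_wpM2r ?powR_ge0//.
apply: (@le_trans _ _ ((1 + l^-1) `^ P)).
  by apply: ler_powR => //; lra.
by apply: ge0_ler_powR => //; rewrite ?nnegrE; lra.
Qed.

Lemma powR_le_shift l p : 1 <= l -> l `^ p <= 2 `^ `|p| * (1 + l) `^ p.
Proof.
move=> l1; have lp : 0 < l `^ p by apply: powR_gt0; lra.
have lp' : 0 < (1 + l) `^ p by apply: powR_gt0; lra.
have := powR_shift_le l (- p) `|p| l1 (normr_ge0 p).
have -> : - p <= `|p| by rewrite -normrN ler_norm.
rewrite !powRN => /(_ isT) H.
by rewrite -ler_pdivrMr// mulrC -ler_pdivlMr.
Qed.

Lemma powR_low_le nu l p : 0 <= l -> l <= nu -> (1 + l) `^ p <= (1 + nu) `^ `|p|.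
Proof.
move=> l0 lnu; apply: (@le_trans _ _ ((1 + l) `^ `|p|)).
  by apply: ler_powR; [lra|exact: ler_norm].
by apply: ge0_ler_powR => //; rewrite ?nnegrE; lra.
Qed.

Lemma powR_low_ge nu l p : 0 <= l -> l <= nu ->
  1 <= (1 + nu) `^ `|p| * (1 + l) `^ p.
Proof.
move=> l0 lnu; have := powR_low_le nu l (- p) l0 lnu.
have lp : 0 < (1 + l) `^ p by apply: powR_gt0; lra.
by rewrite normrN powRN -[(_ `^ p)^-1]mul1r ler_pdivrMr.
Qed.

Lemma powR_sqr l p : 0 <= l -> (l `^ p) ^+ 2 = l `^ (2 * p).
Proof. by move=> l0; rewrite -powR_mulrn ?powR_ge0// -powRrM mulrC. Qed.

Variables (delta sigma m : R).
Hypothesis delta0 : 0 < delta.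
Hypothesis hsigma : (2^-1 < sigma /\ sigma < 1) \/
                    (sigma = 2^-1 /\ m < 4 * delta ^+ 2).

(** For sigma > 1/2 the largest rate allowed by the first condition is kept and [nu] is taken large.
    For sigma = 1/2 both powers of l coincide, a large [nu] gains nothing, and the slack in m < 4
    delta^2 is spent on [r]. No coefficient c is given at this point, so [m] may be negative, whence
    the absolute values. *)
Lemma exists_decay_rate : exists r, [/\ 0 < r, r <= (2 * delta)^-1 &
  exists nu, 1 <= nu /\ forall l, nu <= l ->
    m * (l `^ (2 * (1 - sigma)) * ((2 * delta)^-1 + r))
      <= 2 * delta * l `^ (2 * sigma)].
Proof.
have dd : 0 < 2 * delta by rewrite mulr_gt0.
set i := (2 * delta)^-1.
have i0 : 0 < i by rewrite invr_gt0.
have di : 2 * delta * i = 1 by rewrite mulfV// lt0r_neq0.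
case: hsigma => [[s1 s2]|[s1 s2]].
- exists i; split => //.
  (* The quotient is what l^(4 sigma - 2) has to exceed when r = i; the summand 1 ensures
     [nu >= 1]. *)
  pose X := `|m| * (i + i) / (2 * delta) + 1.
  have X1 : 1 <= X.
    by rewrite lerDr divr_ge0 ?(ltW dd)// mulr_ge0// addr_ge0// ltW.
  have s3 : 0 < 4 * sigma - 2 by lra.
  have nu1 : 1 <= X `^ (4 * sigma - 2)^-1.
    have := @ler_powR _ X X1 0 (4 * sigma - 2)^-1; rewrite powRr0; apply.
    by rewrite invr_ge0 ltW.
  exists (X `^ (4 * sigma - 2)^-1); split => // l lX.
  have l1 : 1 <= l by exact: le_trans lX.
  have Xl : X <= l `^ (4 * sigma - 2).
    have -> : X = (X `^ (4 * sigma - 2)^-1) `^ (4 * sigma - 2).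
      by rewrite -powRrM mulVf ?lt0r_neq0// powRr1// (le_trans ler01).
    have l0 : 0 <= l by exact: le_trans l1.
    by apply: ge0_ler_powR => //; rewrite ?nnegrE ?powR_ge0 ?(ltW s3).
  have -> : l `^ (2 * sigma) = l `^ (2 * (1 - sigma)) * l `^ (4 * sigma - 2).
    rewrite -powRD; first by congr (_ `^ _); ring.
    by apply/implyP => _; rewrite lt0r_neq0// (lt_le_trans ltr01).
  rewrite mulrCA [leRHS]mulrCA ler_wpM2l ?powR_ge0//.
  apply: (@le_trans _ _ (2 * delta * X)); last by rewrite ler_wpM2l// ltW.
  apply: (@le_trans _ _ (`|m| * (i + i))).
    by rewrite ler_wpM2r ?ler_norm//; lra.
  by rewrite /X [leRHS]mulrDr mulr1 [2 * delta * _]mulrC divfK ?lt0r_neq0// lerDl ltW.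
- have g0 : 0 < 2 * delta - m * i.
    rewrite -(pmulr_rgt0 _ dd).
    have -> : 2 * delta * (2 * delta - m * i) =
      4 * delta ^+ 2 - m * (2 * delta * i) by ring.
    by rewrite di; lra.
  have m1 : 0 < `|m| + 1 by rewrite ltr_wpDl.
  exists (Num.min i ((2 * delta - m * i) / (`|m| + 1))); split.
  + by rewrite lt_min i0 divr_gt0.
  + by rewrite ge_min lexx.
  exists 1; split => // l l1; set r := Num.min _ _.
  have r0 : 0 <= r by rewrite le_min ltW//= divr_ge0// ltW.
  have rm : r * (`|m| + 1) <= 2 * delta - m * i.
    by rewrite -ler_pdivlMr// ge_min lexx orbT.
  rewrite s1; have -> : 2 * (1 - 2^-1) = 2 * 2^-1 :> R by lra.
  rewrite mulrCA [leRHS]mulrC ler_wpM2l ?powR_ge0//.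
  have : m * r <= `|m| * r by rewrite ler_wpM2r// ler_norm.
  rewrite mulrDr; lra.
Qed.

End Weights.

(** * Componentwise bounds with Gevrey weights *)

Section WeightedBounds.
Context {R : realType}.
Variables (delta sigma m alpha beta r nu : R) (c : R -> R).
Hypothesis delta0 : 0 < delta.
Hypothesis sigma_le : sigma <= 1.
Hypothesis ab1 : 1 - sigma <= alpha - beta.
Hypothesis ab2 : alpha - beta <= sigma.
Hypothesis c_meas : measurable_fun (`[0, +oo[ : set R) c.
Hypothesis c_bnd : forall t, 0 <= t -> 0 <= c t /\ c t <= m.
Hypothesis r0 : 0 < r.
Hypothesis r_le : r <= (2 * delta)^-1.
Hypothesis nu1 : 1 <= nu.
Hypothesis damping : forall l, nu <= l ->
  m * (l `^ (2 * (1 - sigma)) * ((2 * delta)^-1 + r)) <= 2 * delta * l `^ (2 * sigma).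

Let C := primitive0 c.
Let phi l := l `^ (2 * (1 - sigma)).
Let K0 := 5 + 3 / (2 * delta ^+ 2) + 3 * m ^+ 2 / (2 * delta ^+ 4)
   + 4 * m ^+ 2 / delta ^+ 2.

Lemma high_frequency_constant_gt0 : 0 < K0.
Proof.
have d0 n : 0 <= delta ^+ n by rewrite exprn_ge0// ltW.
have h1 : 0 <= 3 / (2 * delta ^+ 2) by rewrite divr_ge0// mulr_ge0.
have h2 : 0 <= 3 * m ^+ 2 / (2 * delta ^+ 4).
  by apply: divr_ge0; apply: mulr_ge0; rewrite ?sqr_ge0.
have h3 : 0 <= 4 * m ^+ 2 / delta ^+ 2.
  by apply: divr_ge0 => //; apply: mulr_ge0; rewrite ?sqr_ge0.
rewrite /K0; lra.
Qed.

(** The conditions on alpha - beta become [phi l <= k <= l^(2 sigma)], and l^(4 alpha) = l^(4 beta)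
    k^2 reduces the claim to the unweighted bound. Since sigma <= 1 forces beta <= alpha, the single
    factor 2^(4 |alpha|) covers both weights and the constant is free of beta. *)
Lemma gevrey_high_frequency_bound (l y0 y1 : R) (y w : R -> R) (T : R) :
  0 <= T -> nu <= l -> component_solution delta sigma c l y0 y1 y w ->
  (1 + l) `^ (4 * beta) * w T ^+ 2 * expR (2 * (r * C T) * phi l) +
  (1 + l) `^ (4 * alpha) * y T ^+ 2 * expR (2 * (r * C T) * phi l) <=
  2 `^ (4 * `|alpha|) * K0 *
    (l `^ (4 * beta) * y1 ^+ 2 + l `^ (4 * alpha) * y0 ^+ 2).
Proof.
move=> T0 nul sol; have l1 : 1 <= l by exact: le_trans nul.
have l0 : 0 < l by lra.
have ln0 : l != 0 by rewrite lt0r_neq0.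
pose k := l `^ (2 * (alpha - beta)).
have lE : l ^+ 2 = phi l * l `^ (2 * sigma).
  rewrite -powRD ?ln0 ?implybT// -powR_mulrn ?ltW//.
  by congr (_ `^ _); ring.
have qk : phi l <= k by apply: ler_powR => //; rewrite ler_pM2l.
have kS : k <= l `^ (2 * sigma) by apply: ler_powR => //; rewrite ler_pM2l.
have S0 : 0 < l `^ (2 * sigma) by exact: powR_gt0.
have := high_frequency_bound delta sigma m l y0 y1 c y w delta0 c_meas c_bnd sol
  (phi l) (l `^ (2 * sigma)) r (powR_ge0 _ _) S0 erefl lE (ltW r0) r_le
  (damping l nul) k T T0 qk kS.
have -> : 2 * r * phi l * primitive0 c T = 2 * (r * C T) * phi l.
  by rewrite /C; ring.
rewrite -/K0; set e := expR _ => H.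
have kE : l `^ (4 * alpha) = l `^ (4 * beta) * k ^+ 2.
  rewrite powR_sqr ?ltW// -powRD ?ln0 ?implybT//.
  by congr (_ `^ _); ring.
have Pa : 0 <= 4 * `|alpha| by rewrite mulr_ge0.
have ba : beta <= alpha by move: ab1 sigma_le; lra.
have h1 := powR_shift_le l (4 * beta) _ l1 Pa.
have h2 := powR_shift_le l (4 * alpha) _ l1 Pa.
have {}h1 : (1 + l) `^ (4 * beta) <= 2 `^ (4 * `|alpha|) * l `^ (4 * beta).
  by apply: h1; rewrite ler_pM2l// (le_trans ba)// ler_norm.
have {}h2 : (1 + l) `^ (4 * alpha) <= 2 `^ (4 * `|alpha|) * l `^ (4 * alpha).
  by apply: h2; rewrite ler_pM2l// ler_norm.
have e0 : 0 <= e by exact: expR_ge0.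
set P := 2 `^ _ in h1 h2 *.
have P0 : 0 <= P by exact: powR_ge0.
apply: (@le_trans _ _ (P * l `^ (4 * beta) * w T ^+ 2 * e +
    P * l `^ (4 * alpha) * y T ^+ 2 * e)).
  by rewrite lerD// ler_wpM2r// ler_wpM2r// sqr_ge0.
rewrite kE.
have -> : P * l `^ (4 * beta) * w T ^+ 2 * e +
    P * (l `^ (4 * beta) * k ^+ 2) * y T ^+ 2 * e =
  P * l `^ (4 * beta) * (e * (w T ^+ 2 + k ^+ 2 * y T ^+ 2)) by ring.
have -> : P * K0 * (l `^ (4 * beta) * y1 ^+ 2 + l `^ (4 * beta) * k ^+ 2 * y0 ^+ 2) =
  P * l `^ (4 * beta) * (K0 * (y1 ^+ 2 + k ^+ 2 * y0 ^+ 2)) by ring.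
by rewrite ler_wpM2l// mulr_ge0 ?powR_ge0.
Qed.

(** This provides the dominating function for continuity in time: the weight is frozen at [C tau],
    [K] is uniform in [s] and l, and the data carry the weights of the spaces to which they
    belong. *)
Lemma gevrey_uniform_bound (tau T : R) : 0 <= tau -> exists2 K, 0 <= K &
  forall (l y0 y1 : R) (y w : R -> R) (s : R),
  0 <= l -> component_solution delta sigma c l y0 y1 y w ->
  tau <= s -> s <= T ->
  (1 + l) `^ (4 * beta) * w s ^+ 2 * expR (2 * (r * C tau) * phi l) +
  (1 + l) `^ (4 * alpha) * y s ^+ 2 * expR (2 * (r * C tau) * phi l) <=
  K * ((1 + l) `^ (4 * beta) * y1 ^+ 2 + (1 + l) `^ (4 * alpha) * y0 ^+ 2).
Proof.
move=> tau0.
have m0 : 0 <= m by have [h1 h2] := c_bnd 0 (lexx 0); exact: le_trans h2.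
have C0 : C 0 = 0 by exact: primitive0_0.
have Cmono s : tau <= s -> C tau <= C s.
  move=> ts; have /andP[+ _] := primitive0_incr c m c_meas c_bnd tau s tau0 ts.
  by rewrite subr_ge0.
have Ctau : 0 <= C tau.
  have /andP[+ _] := primitive0_incr c m c_meas c_bnd 0 tau (lexx _) tau0.
  by rewrite -/C C0 subr0.
pose Kb := 2 `^ `|4 * beta|; pose Ka := 2 `^ `|4 * alpha|.
pose K1 := 2 `^ (4 * `|alpha|) * K0 * (Kb + Ka).
pose J := (1 + nu) `^ `|4 * beta| + (1 + nu) `^ `|4 * alpha|.
(* For l < nu: the first [J] bounds the weights at time [s], the exponentials bound the Gevrey
   factor and the crude growth, and the second [J] restores the weights of the data. *)
pose K2 := J * expR (2 * (r * C tau) * phi nu) * expR ((1 + nu ^+ 2 * m) * T) * J.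
have K00 := high_frequency_constant_gt0.
have Kb0 : 0 <= Kb by exact: powR_ge0.
have Ka0 : 0 <= Ka by exact: powR_ge0.
have K10 : 0 <= K1 by rewrite /K1 mulr_ge0 ?addr_ge0// mulr_ge0 ?powR_ge0// ltW.
have J0 : 0 <= J by rewrite addr_ge0// powR_ge0.
have K20 : 0 <= K2 by rewrite /K2 !mulr_ge0// expR_ge0.
exists (K1 + K2); first exact: addr_ge0.
move=> l y0 y1 y w s l0 sol ts sT.
have s0 : 0 <= s by exact: le_trans ts.
set B := _ + _ * y0 ^+ 2.
have wb : 0 <= (1 + l) `^ (4 * beta) by exact: powR_ge0.
have wa : 0 <= (1 + l) `^ (4 * alpha) by exact: powR_ge0.
have B0 : 0 <= B by rewrite addr_ge0// mulr_ge0// sqr_ge0.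
rewrite [leRHS]mulrDl.
have [nul|lnu] := leP nu l.
  have K2B := mulr_ge0 K20 B0.
  apply: (@le_trans _ _ (K1 * B)); last by rewrite lerDl.
  have := gevrey_high_frequency_bound l y0 y1 y w s s0 nul sol.
  set e := expR _; set e' := expR _ => H.
  have ee : e' <= e.
    rewrite ler_expR ler_wpM2r ?powR_ge0// ler_pM2l// ler_pM2l//.
    exact: Cmono.
  have l1 : 1 <= l by exact: le_trans nul.
  apply: (@le_trans _ _ ((1 + l) `^ (4 * beta) * w s ^+ 2 * e +
      (1 + l) `^ (4 * alpha) * y s ^+ 2 * e)).
    by apply: lerD; (apply: ler_wpM2l; [by rewrite mulr_ge0// sqr_ge0|exact: ee]).
  apply: (le_trans H); rewrite -[in leRHS]mulrA ler_wpM2l//.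
    by rewrite mulr_ge0 ?powR_ge0// ltW.
  rewrite /B mulrDr; apply: lerD.
  - rewrite mulrA ler_wpM2r ?sqr_ge0//.
    apply: (le_trans (powR_le_shift l (4 * beta) l1)).
    by rewrite -/Kb ler_wpM2r// lerDl.
  - rewrite mulrA ler_wpM2r ?sqr_ge0//.
    apply: (le_trans (powR_le_shift l (4 * alpha) l1)).
    by rewrite -/Ka ler_wpM2r// lerDr.
have K1B := mulr_ge0 K10 B0.
apply: (@le_trans _ _ (K2 * B)); last by rewrite lerDr.
have low := low_frequency_bound delta sigma m l y0 y1 c y w delta0 c_meas c_bnd
  sol s s0.
set e' := expR _.
have lnu' := ltW lnu.
have ee : e' <= expR (2 * (r * C tau) * phi nu).
  rewrite ler_expR ler_wpM2l ?mulr_ge0 ?(ltW r0)//.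
  by apply: ge0_ler_powR; rewrite ?nnegrE//; move: sigma_le nu1; lra.
have e0 : 0 <= e' by exact: expR_ge0.
set E := expR (2 * (r * C tau) * phi nu) in ee.
have mono : expR ((1 + l ^+ 2 * m) * s) <= expR ((1 + nu ^+ 2 * m) * T).
  have l2 : 0 <= 1 + l ^+ 2 * m by rewrite addr_ge0// mulr_ge0// sqr_ge0.
  have lnu2 : l ^+ 2 <= nu ^+ 2 by rewrite ler_sqr ?nnegrE//; move: nu1; lra.
  rewrite ler_expR; apply: ler_pM => //.
  by rewrite lerD2l ler_wpM2r.
have y10 : 0 <= y1 ^+ 2 + y0 ^+ 2 by rewrite addr_ge0// sqr_ge0.
have up (p : R) : 0 <= (1 + nu) `^ p by exact: powR_ge0.
apply: (@le_trans _ _ (J * E * (w s ^+ 2 + y s ^+ 2))).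
  have term (p z : R) : (1 + nu) `^ `|p| <= J ->
      (1 + l) `^ p * z ^+ 2 * e' <= J * E * z ^+ 2.
    move=> pJ; rewrite mulrAC; apply: ler_wpM2r; first exact: sqr_ge0.
    apply: ler_pM; [exact: powR_ge0|exact: e0| |exact: ee].
    exact: le_trans (powR_low_le _ _ _ l0 lnu') pJ.
  by rewrite [leRHS]mulrDr; apply: lerD; apply: term; rewrite /J ?lerDl ?lerDr.
rewrite /K2 -/E -[leRHS]mulrA -[leRHS]mulrA; apply: ler_pM.
- by apply: mulr_ge0; [exact: J0|exact: expR_ge0].
- by rewrite addr_ge0// sqr_ge0.
- by [].
apply: (le_trans low); apply: ler_pM => //.
rewrite /B mulrDr; apply: lerD; rewrite mulrA ler_peMl ?sqr_ge0//.
- apply: (le_trans (powR_low_ge nu l (4 * beta) l0 lnu')).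
  by rewrite ler_wpM2r// lerDl.
- apply: (le_trans (powR_low_ge nu l (4 * alpha) l0 lnu')).
  by rewrite ler_wpM2r// lerDr.
Qed.

End WeightedBounds.

(** * Continuity in Gevrey spaces *)

(** Dominated convergence speaks of sequences. The restriction to distance at most 1 from [t] keeps
    the times in a bounded interval, where a dominating function is available. *)
Lemma cvg_within_seq (R : realType) (T : topologicalType) (A : set R) (t : R)
    (f : R -> T) (l : T) :
  (forall x : nat -> R, (forall n, A (x n)) -> (forall n, `|x n - t| <= 1) ->
    x n @[n --> \oo] --> t -> f (x n) @[n --> \oo] --> l) ->
  f s @[s --> within A (nbhs t)] --> l.
Proof.
move=> H V Vl; apply: contrapT => nV.
have ex n : {x : R | [/\ A x, `|x - t| < n.+1%:R^-1 & ~ V (f x)]}.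
  apply: cid; apply: contrapT => nex; apply: nV.
  have n0 : 0 < n.+1%:R^-1 :> R by rewrite invr_gt0.
  have nt : nbhs t (ball t n.+1%:R^-1) by exact: (nbhsx_ballx t _ n0).
  change (nbhs t (fun x => A x -> V (f x))).
  apply: filterS nt => x; rewrite /ball/= distrC => xt Ax.
  by apply: contrapT => nVx; apply: nex; exists x.
pose x n := projT1 (ex n).
have [Ax xt nVx] : [/\ forall n, A (x n), forall n, `|x n - t| < n.+1%:R^-1 &
    forall n, ~ V (f (x n))].
  by split => n; rewrite /x; case: (ex n) => /= z [].
have x1 n : `|x n - t| <= 1.
  by rewrite (le_trans (ltW (xt n)))// invf_le1// ler1n.
have cx : x n @[n --> \oo] --> t.
  apply/cvgrPdist_lt => e e0; near=> n.
  rewrite distrC; apply: (lt_trans (xt n)).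
  by near: n; exact: near_infty_natSinv_lt (PosNum e0).
have [N _ HN] := H x Ax x1 cx V Vl.
exact: (nVx N (HN N (leqnn N))).
Unshelve. all: by end_near. Qed.

Section Spaces.
Context {R : realType} {d : measure_display} {M : measurableType d}.
Context (mu : {measure set M -> \bar R}) (lambda : M -> R).
Hypothesis lambda_meas : measurable_fun setT lambda.

Lemma domA_integrand_measurable (p : R) (f : M -> R) :
  measurable_fun setT f -> measurable_fun setT (fun xi =>
    ((1 + lambda xi) `^ p * f xi ^+ 2)%:E).
Proof.
move=> mf; apply/measurable_EFinP.
apply: measurable_funM; last exact: measurable_funX.
by apply: (measurableT_comp (measurable_powR p)); exact: measurable_funD.
Qed.

Lemma gevrey_integrand_measurable (p s b : R) (f : M -> R) :
  measurable_fun setT f -> measurable_fun setT (fun xi =>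
    ((1 + lambda xi) `^ p * f xi ^+ 2 * expR (s * lambda xi `^ b))%:E).
Proof.
move=> mf; apply/measurable_EFinP; apply: measurable_funM.
  exact/measurable_EFinP/domA_integrand_measurable.
apply: measurableT_comp => //; apply: measurable_funM => //.
exact: (measurableT_comp (measurable_powR b)).
Qed.

Lemma powA_integrand_measurable (p : R) (f : M -> R) :
  measurable_fun setT f -> measurable_fun setT (fun xi =>
    (lambda xi `^ p * f xi ^+ 2)%:E).
Proof.
move=> mf; apply/measurable_EFinP; apply: measurable_funM.
  exact: (measurableT_comp (measurable_powR p)).
exact: measurable_funX.
Qed.

Lemma high_freq_measurable (nu : R) (f : M -> R) :
  measurable_fun setT f -> measurable_fun setT (high_freq lambda nu f).
Proof.
move=> mf; apply: measurable_fun_ifT => //.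
exact: measurable_fun_ler.
Qed.

Lemma gevrey_C0_dominated (b a : R) (rho : R -> R) (u : R -> M -> R) :
  (forall t, 0 <= t -> measurable_fun setT (u t)) ->
  {ae mu, forall xi, {within `[0, +oo[, continuous (u ^~ xi)}} ->
  (forall tau T, 0 < tau -> exists g : M -> R,
    [/\ measurable_fun setT g, forall xi, 0 <= g xi,
      (\int[mu]_xi (g xi)%:E < +oo)%E &
      {ae mu, forall xi, forall s, tau <= s -> s <= T ->
        (1 + lambda xi) `^ (4 * a) * u s xi ^+ 2 *
          expR (2 * rho tau * lambda xi `^ b) <= g xi}]) ->
  gevrey_C0 mu lambda (fun x => x `^ b) rho a u.
Proof.
move=> mu_ cu dom tau tau0.
have W0 xi (x : R) : 0 <= (1 + lambda xi) `^ (4 * a) * x ^+ 2 *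
    expR (2 * rho tau * lambda xi `^ b).
  by rewrite mulr_ge0 ?expR_ge0// mulr_ge0 ?powR_ge0// sqr_ge0.
split => t taut.
  have t0 : 0 <= t by rewrite (le_trans (ltW tau0)).
  split; first exact: mu_.
  have [g [mg g0 gfin gdom]] := dom tau t tau0.
  apply: le_lt_trans gfin; apply: ae_ge0_le_integral => //.
  - by move=> xi _; rewrite lee_fin.
  - by apply: gevrey_integrand_measurable; exact: mu_.
  - by move=> xi _; rewrite lee_fin.
  - exact/measurable_EFinP.
  - by apply: filterS gdom => xi H _; rewrite lee_fin; exact: H.
apply: cvg_within_seq => s stau s1 st.
have {}stau n : tau <= s n by have := stau n; rewrite /= in_itv/= andbT.
have t0 : 0 <= t by rewrite (le_trans (ltW tau0)).
have s0 n : 0 <= s n by rewrite (le_trans (ltW tau0)).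
have [g [mg g0 gfin gdom]] := dom tau (t + 1) tau0.
have mus n : measurable_fun setT (fun xi => u (s n) xi - u t xi).
  by apply: measurable_funB; exact: mu_.
(* The square of a difference is at most twice the sum of the squares, and each weighted square is
   at most [g]; hence the factor 4. *)
have ig : mu.-integrable setT (fun xi => (4 * g xi)%:E).
  apply/integrableP; split.
    by apply/measurable_EFinP; exact: measurable_funM.
  under eq_integral => xi _.
    rewrite gee0_abs; last by rewrite lee_fin mulr_ge0.
    rewrite EFinM.
    over.
  rewrite ge0_integralZl_EFin//; last 2 first.
    by move=> xi _; rewrite lee_fin.
    exact/measurable_EFinP.
  by rewrite lte_mul_pinfty.
pose F n xi := ((1 + lambda xi) `^ (4 * a) * (u (s n) xi - u t xi) ^+ 2 *
  expR (2 * rho tau * lambda xi `^ b))%:E.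
have cF : {ae mu, forall xi, setT xi -> F n xi @[n --> \oo] --> 0%E}.
  apply: filterS cu => xi cxi _ /=.
  apply: cvg_EFin; first by near=> n.
  rewrite /comp/=.
  have cs : u (s n) xi @[n --> \oo] --> u t xi.
    have := (subspace_continuousP _ _).1 cxi t.
    rewrite /= in_itv/= andbT => /(_ t0) ct.
    have ws : s n @[n --> \oo] --> within `[0, +oo[ (nbhs t).
      move=> V wV.
      have [N _ HN] := st _ (wV : nbhs t (fun x => `[0, +oo[%classic x -> V x)).
      by exists N => // n /HN /=; apply; rewrite in_itv/= andbT.
    exact: (cvg_comp _ _ ws ct).
  have cz : u (s n) xi - u t xi @[n --> \oo] --> 0.
    by rewrite -(subrr (u t xi)); apply: cvgB => //; exact: cvg_cst.
  have : (1 + lambda xi) `^ (4 * a) * (u (s n) xi - u t xi) ^+ 2 *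
    expR (2 * rho tau * lambda xi `^ b) @[n --> \oo] -->
    (1 + lambda xi) `^ (4 * a) * (0 * 0) * expR (2 * rho tau * lambda xi `^ b).
    apply: cvgM; last exact: cvg_cst.
    by apply: cvgM; [exact: cvg_cst|exact: cvgM].
  by rewrite !(mulr0, mul0r).
have Fg : {ae mu, forall xi n, setT xi -> (`|F n xi| <= (4 * g xi)%:E)%E}.
  apply: filterS gdom => xi H n _ /=.
  rewrite lee_fin ger0_norm//.
  set A := (1 + lambda xi) `^ _; set e := expR _.
  have h1 := H (s n) (stau n).
  have st1 : s n <= t + 1 by have := ler_norm (s n - t); have := s1 n; lra.
  have {}h1 := h1 st1.
  have h2 := H t taut.
  have {}h2 : A * u t xi ^+ 2 * e <= g xi by apply: h2; lra.
  rewrite -/A -/e in h1.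
  have Ae : 0 <= A * e by rewrite mulr_ge0 ?expR_ge0 ?powR_ge0.
  have := mulr_ge0 Ae (sqr_ge0 (u (s n) xi + u t xi)).
  lra.
have [_ _] := @dominated_convergence _ _ _ mu _ measurableT F (cst 0%E) _
  (fun n => gevrey_integrand_measurable _ _ _ _ (mus n)) (measurable_cst _)
  cF ig Fg.
by rewrite integral_cst// mul0e.
Unshelve. all: by end_near. Qed.

End Spaces.

(** * Integration over the spectrum *)

Theorem theorem3p8 (R : realType) (delta mu2 sigma : R)
  (hdelta : 0 < delta)
  (hsigma : (2^-1 < sigma /\ sigma < 1) \/
            (sigma = 2^-1 /\ mu2 < 4 * delta ^+ 2)) :
  exists r : R, 0 < r /\ exists nu : R, 1 <= nu /\
  forall alpha : R, exists K : R, 0 < K /\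
  forall (beta : R)
    (hab : 1 - sigma <= alpha - beta /\ alpha - beta <= sigma)
    (H : completeNormedModType R) (ip : {dot H for idfun})
    (hip : is_inner_product_norm ip) (hsep : separable_space H)
    (D : set H) (A : H -> H) (hA : nonneg_selfadjoint ip D A)
    (d : measure_display) (M : measurableType d)
    (mu : {measure set M -> \bar R}) (lambda : M -> R) (U : H -> M -> R)
    (hspec : spectral_representation ip D A mu lambda U)
    (c : R -> R) (hcm : measurable_fun (`[0, +oo[ : set R) c)
    (hc : forall t, 0 <= t -> 0 <= c t /\ c t <= mu2)
    (u0 u1 : M -> R)
    (hu0 : in_domA mu lambda alpha u0) (hu1 : in_domA mu lambda beta u1)
    (u v : R -> M -> R)
    (hu : is_solution mu lambda delta sigma c u0 u1 u v),
  let phi := fun x : R => x `^ (2 * (1 - sigma)) in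
  let C := primitive0 c in
  (gevrey_C0 mu lambda phi (fun t => r * C t) alpha u /\
   gevrey_C0 mu lambda phi (fun t => r * C t) beta v) /\
  (forall t : R, 0 < t ->
    (gevrey_sqnorm mu lambda phi (r * C t) beta (high_freq lambda nu (v t)) +
     gevrey_sqnorm mu lambda phi (r * C t) alpha (high_freq lambda nu (u t))
     <= K%:E * (powA_sqnorm mu lambda beta (high_freq lambda nu u1) +
                powA_sqnorm mu lambda alpha (high_freq lambda nu u0)))%E).
Proof.
have sigma_le : sigma <= 1 by case: hsigma => [[_ /ltW//]|[-> _]]; lra.
have [r [r0 r_le [nu [nu1 damping]]]] := exists_decay_rate delta sigma mu2 hdelta hsigma.
exists r; split => //; exists nu; split => // alpha.
pose K0 := 5 + 3 / (2 * delta ^+ 2) + 3 * mu2 ^+ 2 / (2 * delta ^+ 4)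
  + 4 * mu2 ^+ 2 / delta ^+ 2.
pose K := 2 `^ (4 * `|alpha|) * K0.
have K_gt0 : 0 < K.
  by rewrite mulr_gt0 ?powR_gt0//; exact: high_frequency_constant_gt0.
exists K; split => // beta [ab1 ab2] H ip _ _ D A _ d M mu lambda U hspec.
move=> c hcm hc u0 u1 [mu0 fu0] [mu1 fu1] u v [muv sol] phi C.
have lm := sr_meas hspec; have l0 := sr_ge0 hspec.
have B0 xi (p z : R) : 0 <= (1 + lambda xi) `^ p * z ^+ 2.
  by rewrite mulr_ge0 ?powR_ge0// sqr_ge0.
(* The componentwise bound controls the sum of both weighted squares, so one [g] dominates [u] and
   [v] alike. *)
have dominant tau T : 0 < tau -> exists g : M -> R,
    [/\ measurable_fun setT g, forall xi, 0 <= g xi,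
      (\int[mu]_xi (g xi)%:E < +oo)%E &
      {ae mu, forall xi, forall s, tau <= s -> s <= T ->
        (1 + lambda xi) `^ (4 * beta) * v s xi ^+ 2 *
          expR (2 * (r * C tau) * lambda xi `^ (2 * (1 - sigma))) +
        (1 + lambda xi) `^ (4 * alpha) * u s xi ^+ 2 *
          expR (2 * (r * C tau) * lambda xi `^ (2 * (1 - sigma))) <= g xi}].
  move=> tau0.
  have [k k0 Hk] := gevrey_uniform_bound delta sigma mu2 alpha beta r nu c hdelta
    sigma_le ab1 ab2 hcm hc r0 r_le nu1 damping tau T (ltW tau0).
  exists (fun xi => k * ((1 + lambda xi) `^ (4 * beta) * u1 xi ^+ 2 +
    (1 + lambda xi) `^ (4 * alpha) * u0 xi ^+ 2)).
  have m1 := domA_integrand_measurable lambda lm (4 * beta) u1 mu1.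
  have m0 := domA_integrand_measurable lambda lm (4 * alpha) u0 mu0.
  split.
  - apply: measurable_funM => //.
    by apply: measurable_funD; exact/measurable_EFinP.
  - by move=> xi; rewrite mulr_ge0// addr_ge0.
  - under eq_integral do rewrite EFinM EFinD.
    rewrite ge0_integralZl_EFin//; last 2 first.
    + by move=> xi _; rewrite adde_ge0// lee_fin.
    + exact: emeasurable_funD.
    rewrite ge0_integralD//; last 2 first.
    + by move=> xi _; rewrite lee_fin.
    + by move=> xi _; rewrite lee_fin.
    by rewrite lte_mul_pinfty ?lee_fin// lte_add_pinfty.
  - apply: filterS sol => xi sxi s taus sT.
    exact: Hk (l0 xi) sxi taus sT.
split.
  split.
  - apply: gevrey_C0_dominated => //.
    + by move=> t /muv[].
    + by apply: filterS sol => xi [dy _ _ _ _]; exact: (halfline_continuous _ _ dy).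
    + move=> tau T tau0; have [g [mg g0 fg Hg]] := dominant tau T tau0.
      exists g; split => //; apply: filterS Hg => xi Hg s taus sT.
      apply: le_trans (Hg s taus sT); rewrite lerDr mulr_ge0// expR_ge0//.
  - apply: gevrey_C0_dominated => //.
    + by move=> t /muv[].
    + by apply: filterS sol => xi [].
    + move=> tau T tau0; have [g [mg g0 fg Hg]] := dominant tau T tau0.
      exists g; split => //; apply: filterS Hg => xi Hg s taus sT.
      apply: le_trans (Hg s taus sT); rewrite lerDl mulr_ge0// expR_ge0//.
move=> t t0.
have [mut mvt] := muv t (ltW t0).
have hm f : measurable_fun setT f -> measurable_fun setT (high_freq lambda nu f).
  exact: high_freq_measurable.
have L0 xi (p z : R) : 0 <= lambda xi `^ p * z ^+ 2.
  by rewrite mulr_ge0 ?powR_ge0// sqr_ge0.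
rewrite /gevrey_sqnorm /powA_sqnorm.
(* Both sides become single integrals, because the componentwise estimate compares the sums and
   mixes the two data. Where [lambda xi < nu] both integrands vanish. *)
rewrite -ge0_integralD//; last 4 first.
- by move=> xi _; rewrite lee_fin mulr_ge0// expR_ge0.
- by apply: gevrey_integrand_measurable => //; exact: hm.
- by move=> xi _; rewrite lee_fin mulr_ge0// expR_ge0.
- by apply: gevrey_integrand_measurable => //; exact: hm.
rewrite -ge0_integralD//; last 4 first.
- by move=> xi _; rewrite lee_fin.
- by apply: powA_integrand_measurable => //; exact: hm.
- by move=> xi _; rewrite lee_fin.
- by apply: powA_integrand_measurable => //; exact: hm.
rewrite -ge0_integralZl_EFin//; last 3 first.
- by move=> xi _; rewrite adde_ge0// lee_fin.
- by apply: emeasurable_funD; apply: powA_integrand_measurable => //; exact: hm.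
- exact: ltW.
apply: ae_ge0_le_integral => //.
- by move=> xi _; rewrite adde_ge0// lee_fin mulr_ge0// expR_ge0.
- by apply: emeasurable_funD; apply: gevrey_integrand_measurable => //; exact: hm.
- by move=> xi _; rewrite mule_ge0 ?adde_ge0// lee_fin// ltW.
- apply: measurable_funeM.
  by apply: emeasurable_funD; apply: powA_integrand_measurable => //; exact: hm.
apply: filterS sol => xi sxi _.
rewrite -!EFinD -EFinM lee_fin /high_freq.
case: ifPn => [nul|_]; last by rewrite !expr0n/= !mulr0 !mul0r addr0 mulr0.
exact: (gevrey_high_frequency_bound delta sigma mu2 alpha beta r nu c hdelta
  sigma_le ab1 ab2 hcm hc r0 r_le nu1 damping _ _ _ _ _ t (ltW t0) nul sxi).
Qed.
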